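(* For a set $\mathcal A\subset\mathbb R$ let $\chi_{\mathcal A}$ denote its characteristic function, and for $x\ge 1$ define $$\varphi(x):=\sum_{m=1}^\infty\sum_{n=1}^\infty\int_1^x\chi_{[2m-1,2m)}\!\left(\frac{x}{u}\right)\chi_{[2n-1,2n)}(u)\,\frac{du}{u},$$ where $[a,b)=\{x: a\le x<b\}$. Then for any given $\varepsilon>0$, $$\varphi(x)=\tfrac14\log x+\tfrac12\log\!\left(\tfrac{\pi}{2}\right)+O_\varepsilon\!\left(x^{\varepsilon-\frac14}\right)\qquad(x\ge1).$$
   Context: $O_\varepsilon$ means the implied constant may depend on $\varepsilon$ only. *)

(* Defs.v *)
From Stdlib Require Import Reals Lra Lia ClassicalEpsilon.
From Coquelicot Require Import Coquelicot.
Open Scope R_scope.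

Definition chi (A : R -> Prop) (x : R) : R :=
  if excluded_middle_informative (A x) then 1 else 0.

Definition Ico (a b : R) : R -> Prop := fun x => a <= x < b.

Definition phi_integrand (x : R) (m n : nat) (u : R) : R :=
  chi (Ico (2 * INR m - 1) (2 * INR m)) (x / u) *
  chi (Ico (2 * INR n - 1) (2 * INR n)) u / u.

(* [Series a] sums [a] from index 0, so the summation indices 1, 2, 3, ... are
   written [S m] and [S n].  [RInt] and [Series] are total; the lemmas below
   show that, for [1 <= x], every integral and series here converges. *)
Definition phi (x : R) : R :=
  Series (fun m => Series (fun n => RInt (phi_integrand x (S m) (S n)) 1 x)).

Lemma chi_in (A : R -> Prop) (x : R) : A x -> chi A x = 1.
Proof. unfold chi; destruct (excluded_middle_informative (A x)); tauto. Qed.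

Lemma chi_notin (A : R -> Prop) (x : R) : ~ A x -> chi A x = 0.
Proof. unfold chi; destruct (excluded_middle_informative (A x)); tauto. Qed.

Lemma ex_RInt_cut_left (f g : R -> R) (p q c : R) : p <= q -> ex_RInt f p q ->
  (forall u, p < u < q -> c < u -> g u = f u) ->
  (forall u, p < u < q -> u < c -> g u = 0) -> ex_RInt g p q.
Proof.
intros Hpq Hf H1 H0.
destruct (Rle_lt_dec c p) as [Hc|Hc].
{ apply (ex_RInt_ext f); [|exact Hf].
  rewrite Rmin_left, Rmax_right by lra.
  intros u Hu; symmetry; apply H1; lra. }
destruct (Rle_lt_dec q c) as [Hd|Hd].
{ apply (ex_RInt_ext (fun _ => 0)); [|apply ex_RInt_const].
  rewrite Rmin_left, Rmax_right by lra.
  intros u Hu; symmetry; apply H0; lra. }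
apply (ex_RInt_Chasles g p c q).
- apply (ex_RInt_ext (fun _ => 0)); [|apply ex_RInt_const].
  rewrite Rmin_left, Rmax_right by lra.
  intros u Hu; symmetry; apply H0; lra.
- apply (ex_RInt_ext f).
  + rewrite Rmin_left, Rmax_right by lra.
    intros u Hu; symmetry; apply H1; lra.
  + apply (ex_RInt_Chasles_2 f p c q); [lra|exact Hf].
Qed.

Lemma ex_RInt_cut_right (f g : R -> R) (p q c : R) : p <= q -> ex_RInt f p q ->
  (forall u, p < u < q -> u < c -> g u = f u) ->
  (forall u, p < u < q -> c < u -> g u = 0) -> ex_RInt g p q.
Proof.
intros Hpq Hf H1 H0.
apply (ex_RInt_ext (fun u => minus (f u) (minus (f u) (g u)))).
{ intros u _; unfold minus, plus, opp; simpl; ring. }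
apply (ex_RInt_minus (V := R_NormedModule)); [exact Hf|].
apply (ex_RInt_cut_left f _ p q c); trivial.
- intros u Hu Hc; rewrite (H0 u Hu Hc); unfold minus, plus, opp; simpl; ring.
- intros u Hu Hc; rewrite (H1 u Hu Hc); unfold minus, plus, opp; simpl; ring.
Qed.

Lemma ex_RInt_phi_integrand (x : R) (m n : nat) :
  1 <= x -> ex_RInt (phi_integrand x (S m) (S n)) 1 x.
Proof.
intros Hx.
assert (Hm : 1 <= INR (S m)) by (rewrite S_INR; pose proof (pos_INR m); lra).
set (M := INR (S m)) in *; set (N := INR (S n)).
set (A := fun u : R => chi (fun v => 2 * N - 1 <= v) u / u).
set (B := fun u : R => chi (Ico (2 * N - 1) (2 * N)) u / u).
set (C := fun u : R => chi (fun v => 2 * M - 1 <= v) (x / u) * B u).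
assert (HA : ex_RInt A 1 x).
{ apply (ex_RInt_cut_left (fun u => / u) _ 1 x (2 * N - 1)); trivial.
  - apply (ex_RInt_continuous (V := R_CompleteNormedModule)).
    rewrite Rmin_left, Rmax_right by lra.
    intros z Hz; apply continuous_Rinv; lra.
  - intros u Hu Hc; unfold A; rewrite chi_in by lra; field; lra.
  - intros u Hu Hc; unfold A; rewrite chi_notin by lra; field; lra. }
assert (HB : ex_RInt B 1 x).
{ apply (ex_RInt_cut_right A _ 1 x (2 * N)); trivial.
  - intros u Hu Hc; unfold A, B; f_equal.
    destruct (Rle_lt_dec (2 * N - 1) u).
    + rewrite !chi_in; trivial; unfold Ico; lra.
    + rewrite !chi_notin; trivial; unfold Ico; lra.
  - intros u Hu Hc; unfold B; rewrite chi_notin by (unfold Ico; lra); field; lra. }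
assert (Hlow : forall c u, 0 < c -> 0 < u -> u < x / c -> c < x / u).
{ intros c u Hc Hu H; apply (Rmult_lt_reg_r u); [lra|].
  apply (Rmult_lt_compat_r c) in H; [|lra].
  replace (x / c * c) with x in H by (field; lra).
  replace (x / u * u) with x by (field; lra); lra. }
assert (Hupp : forall c u, 0 < c -> 0 < u -> x / c < u -> x / u < c).
{ intros c u Hc Hu H; apply (Rmult_lt_reg_r u); [lra|].
  apply (Rmult_lt_compat_r c) in H; [|lra].
  replace (x / c * c) with x in H by (field; lra).
  replace (x / u * u) with x by (field; lra); lra. }
assert (HC : ex_RInt C 1 x).
{ apply (ex_RInt_cut_right B _ 1 x (x / (2 * M - 1))); trivial.
  - intros u Hu Hc; unfold C; apply Hlow in Hc; try lra.
    rewrite chi_in by lra; ring.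
  - intros u Hu Hc; unfold C; apply Hupp in Hc; try lra.
    rewrite chi_notin by lra; ring. }
apply (ex_RInt_cut_left C _ 1 x (x / (2 * M))); trivial.
- intros u Hu Hc; apply Hupp in Hc; try lra.
  unfold phi_integrand, C, B; fold M N.
  destruct (Rle_lt_dec (2 * M - 1) (x / u)).
  + rewrite (chi_in _ (x / u)), (chi_in _ (x / u)) by (unfold Ico; lra); field; lra.
  + rewrite (chi_notin _ (x / u)), (chi_notin _ (x / u)) by (unfold Ico; lra); field; lra.
- intros u Hu Hc; apply Hlow in Hc; try lra.
  unfold phi_integrand; fold M N.
  rewrite (chi_notin _ (x / u)) by (unfold Ico; lra); field; lra.
Qed.

Lemma RInt_phi_integrand_eq0 (x : R) (m n : nat) : 1 <= x ->
  x < INR (S m) \/ x < INR (S n) -> RInt (phi_integrand x (S m) (S n)) 1 x = 0.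
Proof.
intros Hx H.
rewrite (RInt_ext _ (fun _ => 0)).
{ rewrite RInt_const; exact (Rmult_0_r (x - 1)). }
rewrite Rmin_left, Rmax_right by lra.
intros u Hu; change (phi_integrand x (S m) (S n) u = 0 :> R).
unfold phi_integrand.
destruct H as [H|H].
- assert (Hxu : x / u < x).
  { apply (Rmult_lt_reg_r u); [lra|].
    replace (x / u * u) with x by (field; lra); nra. }
  rewrite (chi_notin _ (x / u)) by (unfold Ico; lra); field; lra.
- rewrite (chi_notin _ u) by (unfold Ico; lra); field; lra.
Qed.

Lemma ex_series_eventually0 (a : nat -> R) (N : nat) :
  (forall n, (N <= n)%nat -> a n = 0) -> ex_series a.
Proof.
intros H; apply (ex_series_incr_n a N).
apply (ex_series_ext (fun n => 0 * (/ 2) ^ n)).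
{ intros n; rewrite H by lia; exact (Rmult_0_l _). }
apply (ex_series_scal (K := R_AbsRing) (V := R_NormedModule) 0 (fun n => (/ 2) ^ n)).
apply ex_series_geom; rewrite Rabs_pos_eq; lra.
Qed.

Lemma ex_series_phi_inner (x : R) (m : nat) : 1 <= x ->
  ex_series (fun n => RInt (phi_integrand x (S m) (S n)) 1 x).
Proof.
intros Hx; destruct (INR_unbounded x) as [N HN].
apply (ex_series_eventually0 _ N); intros n Hn.
apply RInt_phi_integrand_eq0; trivial; right.
apply le_INR in Hn; rewrite S_INR; lra.
Qed.

Lemma ex_series_phi_outer (x : R) : 1 <= x ->
  ex_series (fun m => Series (fun n => RInt (phi_integrand x (S m) (S n)) 1 x)).
Proof.
intros Hx; destruct (INR_unbounded x) as [N HN].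
apply (ex_series_eventually0 _ N); intros m Hm.
rewrite (Series_ext _ (fun n => 0 * 0)).
{ rewrite Series_scal_l; ring. }
intros n; rewrite Rmult_0_l; apply RInt_phi_integrand_eq0; trivial; left.
apply le_INR in Hm; rewrite S_INR; lra.
Qed.

(* Main.v *)
(** The Mellin convolution defining [phi x] is the finite sum over [a, b] of
    [(-1)^(a+b) max(0, ln (x / (a b)))].  By the Dirichlet hyperbola method at
    [N = floor (sqrt x)] everything reduces to the one-dimensional sums
    [sum_(b <= y) (-1)^(b-1) ln (y / b)
       = ln y / 2 + ln (PI / 2) / 2 + S(y) / y + O(1 / y^2)],
    where the constant comes from Wallis' product and [S] is a mean-zero triangular
    wave of period 2.  The error is then governed by
    [(1 / x) * sum_(n <= N) (-1)^n n S(x / n)].  Expanding [S] in its Fourier series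
    [2 / PI^2 * sum_(k odd) cos (k PI v) / k^2] leaves exponential sums with phase
    [k x / (2 n)], bounded by [O((k x)^(3/4))] by van der Corput's second derivative
    method; the sum over [k] converges, so the total error is [O(x^(-1/4))]. *)

Require Import Defs.
From Stdlib Require Import Reals Lra Lia.
From Coquelicot Require Import Coquelicot.
Open Scope R_scope.

(** * Finite sums *)

(** Van der Corput's method is run on real numbers. With [u] and [v] the cosine and sine terms,
    signs included, and [PI w] half the difference of consecutive phases, one has [cos (PI w) (u_i +
    u_(i+1)) = sin (PI w) (v_(i+1) - v_i)]: pairs of neighbours are summed by parts against a
    tangent, which is monotone on each block [|w - r| <= 1/2]. The obstacle is the weight [n]. With
    [y = k x], block [r] has [n] at most of order [(y / (r + 1))^(1/2)] and contributes
    [O(y^(3/4) (r + 1)^(-5/4))], so the blocks add up without a logarithm. The Fourier series is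
    used only pointwise: the bound is uniform in the truncation, so no rate of convergence enters,
    but the limit must also hold at the corners of the wave, which are met whenever [x / n] is an
    integer. The parameter [g = x^(1/4)] makes all exponents integers. *)

Fixpoint psum (f : nat -> R) (n : nat) : R :=
  match n with O => 0 | S m => psum f m + f m end.

Lemma psum_ext (f g : nat -> R) (n : nat) :
  (forall i, (i < n)%nat -> f i = g i) -> psum f n = psum g n.
Proof.
induction n as [|n IH]; intros H; simpl; trivial.
rewrite IH, H; auto with arith.
Qed.

Lemma psum_plus (f g : nat -> R) (n : nat) :
  psum (fun i => f i + g i) n = psum f n + psum g n.
Proof. induction n as [|n IH]; simpl; lra. Qed.

Lemma psum_scal (c : R) (f : nat -> R) (n : nat) :
  psum (fun i => c * f i) n = c * psum f n.
Proof. induction n as [|n IH]; simpl; [ring|rewrite IH; ring]. Qed.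

Lemma psum_const (c : R) (n : nat) : psum (fun _ => c) n = INR n * c.
Proof. induction n as [|n IH]; [simpl; ring|rewrite S_INR; simpl; lra]. Qed.

Lemma psum_le (f g : nat -> R) (n : nat) :
  (forall i, (i < n)%nat -> f i <= g i) -> psum f n <= psum g n.
Proof.
induction n as [|n IH]; intros H; simpl; [lra|].
apply Rplus_le_compat; auto with arith.
Qed.

Lemma psum_Rabs (f : nat -> R) (n : nat) :
  Rabs (psum f n) <= psum (fun i => Rabs (f i)) n.
Proof.
induction n as [|n IH]; simpl; [rewrite Rabs_R0; lra|].
eapply Rle_trans; [apply Rabs_triang|lra].
Qed.

Lemma psum_Rabs_le (f g : nat -> R) (n : nat) :
  (forall i, (i < n)%nat -> Rabs (f i) <= g i) -> Rabs (psum f n) <= psum g n.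
Proof.
intros H; eapply Rle_trans; [apply psum_Rabs|now apply psum_le].
Qed.

Lemma psum_add (f : nat -> R) (n m : nat) :
  psum f (n + m) = psum f n + psum (fun i => f (n + i)%nat) m.
Proof.
induction m as [|m IH]; simpl; [rewrite Nat.add_0_r; ring|].
rewrite Nat.add_succ_r; simpl; lra.
Qed.

Lemma psum_succ_l (f : nat -> R) (n : nat) :
  psum f (S n) = f O + psum (fun i => f (S i)) n.
Proof. change (S n) with (1 + n)%nat; rewrite psum_add; simpl; ring. Qed.

Lemma psum_swap (f : nat -> nat -> R) (n m : nat) :
  psum (fun i => psum (f i) m) n = psum (fun j => psum (fun i => f i j) n) m.
Proof.
induction n as [|n IH]; simpl; [rewrite psum_const; ring|].
now rewrite psum_plus, IH.
Qed.

Lemma psum_double (f : nat -> R) (n : nat) :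
  psum f (2 * n) = psum (fun i => f (2 * i)%nat + f (2 * i + 1)%nat) n.
Proof.
induction n as [|n IH]; [reflexivity|].
replace (2 * S n)%nat with (S (S (2 * n))) by lia.
cbn [psum]; rewrite IH; replace (2 * n + 1)%nat with (S (2 * n)) by lia; ring.
Qed.

Lemma psum_telescope (f : nat -> R) (n : nat) :
  psum (fun i => f i - f (S i)) n = f O - f n.
Proof. induction n as [|n IH]; simpl; lra. Qed.

Lemma is_lim_seq_psum (f : nat -> nat -> R) (l : nat -> R) (n : nat) :
  (forall i, (i < n)%nat -> is_lim_seq (f i) (l i)) ->
  is_lim_seq (fun J => psum (fun i => f i J) n) (psum l n).
Proof.
induction n as [|n IH]; intros H; simpl; [apply is_lim_seq_const|].
apply is_lim_seq_plus'; auto with arith.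
Qed.

(** Summation by parts: the two boundary values of [T] cost [H] each, and the total variation of the
    antitone [T] is at most [2 * H]. *)
Lemma psum_abel_monotone (v T : nat -> R) (H : R) (n : nat) :
  (forall i, Rabs (v i) <= 1) ->
  (forall i, (i < n)%nat -> Rabs (T i) <= H) ->
  (forall i, (S i < n)%nat -> T (S i) <= T i) ->
  0 <= H -> Rabs (psum (fun i => (v (S i) - v i) * T i) n) <= 4 * H.
Proof.
intros Hv HT Hm H_pos.
destruct n as [|n].
{ simpl; rewrite Rabs_R0; lra. }
assert (E : forall k, (k <= n)%nat ->
  Rabs (psum (fun i => (v (S i) - v i) * T i) (S k) - v (S k) * T k)
   <= Rabs (T O) + (T O - T k)).
{ induction k as [|k IH]; intros Hk.
  - simpl. replace (_ - _) with (- v O * T O) by ring.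
    rewrite Rabs_mult, Rabs_Ropp.
    pose proof (Hv O); pose proof (Rabs_pos (T O)); nra.
  - cbn [psum] in *.
    specialize (IH ltac:(lia)). specialize (Hm k ltac:(lia)).
    replace (_ - _) with
     (psum (fun i => (v (S i) - v i) * T i) k + (v (S k) - v k) * T k - v (S k) * T k
      + v (S k) * (T k - T (S k))) by ring.
    eapply Rle_trans; [apply Rabs_triang|].
    rewrite (Rabs_mult (v (S k))), (Rabs_pos_eq (T k - T (S k))) by lra.
    pose proof (Hv (S k)); nra. }
specialize (E n (Nat.le_refl n)).
pose proof (HT O ltac:(lia)) as H0; pose proof (HT n ltac:(lia)) as Hn.
pose proof (Hv (S n)) as Hvn.
assert (Rabs (v (S n) * T n) <= H).
{ rewrite Rabs_mult; pose proof (Rabs_pos (T n)); nra. }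
pose proof (Rle_abs (T O)); pose proof (Rle_abs (- T n)); rewrite Rabs_Ropp in *.
replace (psum _ _) with
  (psum (fun i => (v (S i) - v i) * T i) (S n) - v (S n) * T n + v (S n) * T n) by ring.
eapply Rle_trans; [apply Rabs_triang|lra].
Qed.

(** * Kusmin-Landau on one period of the tangent *)

(** Monotone retraction of the line onto an interval. It serves both to count separated points and
    to keep the tangent away from its poles. *)
Definition clamp (a b x : R) : R := Rmax a (Rmin b x).

Lemma clamp_bounds (a b x : R) : a <= b -> a <= clamp a b x <= b.
Proof.
intros H; unfold clamp, Rmax, Rmin.
destruct (Rle_dec b x), (Rle_dec a _); lra.
Qed.

Lemma clamp_id (a b x : R) : a <= x <= b -> clamp a b x = x.
Proof. intros H; unfold clamp; rewrite Rmin_right, Rmax_right; lra. Qed.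

Lemma clamp_incr (a b x y : R) : x <= y -> clamp a b x <= clamp a b y.
Proof.
intros H; unfold clamp.
apply Rle_max_compat_l; apply Rle_min_compat_l; exact H.
Qed.

Definition indic (a b x : R) : R :=
  if Rle_dec a x then if Rle_dec x b then 1 else 0 else 0.

(* Each point of [[a, b]] moves the clamp to [[a - delta, b]] by at least
   [delta], and the clamp moves by at most [b - a + delta] altogether. *)
Lemma spaced_count (w : nat -> R) (a b delta : R) (n : nat) :
  a <= b -> 0 < delta ->
  (forall i, (i < n)%nat -> w (S i) + delta <= w i) ->
  psum (fun i => indic a b (w i)) n <= (b - a) / delta + 1.
Proof.
intros Hab Hd Hw.
set (c := clamp (a - delta) b).
assert (H : psum (fun i => indic a b (w i)) n
            <= psum (fun i => / delta * (c (w i) - c (w (S i)))) n).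
{ apply psum_le; intros i Hi; specialize (Hw i Hi).
  apply (Rmult_le_reg_l delta); trivial.
  rewrite <- Rmult_assoc, Rinv_r, Rmult_1_l by lra.
  pose proof (clamp_incr (a - delta) b (w (S i)) (w i) ltac:(lra)) as Hc.
  unfold indic; destruct (Rle_dec a (w i)), (Rle_dec (w i) b); try (fold c in Hc; lra).
  assert (c (w (S i)) <= w i - delta); [|unfold c at 1; rewrite clamp_id; lra].
  rewrite <- (clamp_id (a - delta) b (w i - delta)) by lra.
  apply clamp_incr; lra. }
rewrite psum_scal, (psum_telescope (fun i => c (w i))) in H.
eapply Rle_trans; [exact H|].
apply (Rmult_le_reg_l delta); trivial.
rewrite <- Rmult_assoc, Rinv_r, Rmult_1_l by lra.
replace (delta * ((b - a) / delta + 1)) with (b - a + delta) by (field; lra).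
pose proof (clamp_bounds (a - delta) b (w O) ltac:(lra)) as H0.
pose proof (clamp_bounds (a - delta) b (w n) ltac:(lra)) as Hn.
fold c in H0, Hn; lra.
Qed.

Lemma cos_ge_half (x : R) : Rabs x <= PI / 3 -> 1 / 2 <= cos x.
Proof.
intros Hx; pose proof PI_RGT_0 as HPI.
assert (H : cos (PI / 3) <= cos (Rabs x)).
{ pose proof (Rabs_pos x).
  destruct (Rle_lt_or_eq_dec _ _ Hx) as [E|E]; [|rewrite E; lra].
  left; apply cos_decreasing_1; lra. }
rewrite cos_PI3 in H.
unfold Rabs in H; destruct (Rcase_abs x); rewrite ?cos_neg in H; lra.
Qed.

(** By the mean value theorem: up to [PI / 3] the cosine is at least 1/2, and [PI >= 2]. This caps
    the tangent at distance [eta] from a pole by [1 / eta]. *)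
Lemma sin_PI_mult_ge (eta : R) : 0 <= eta <= 1 / 3 -> eta <= sin (PI * eta).
Proof.
intros H; pose proof PI_RGT_0 as HPI; pose proof PI2_1 as HPI2.
destruct (MVT_gen sin 0 (PI * eta) cos) as [c [Hc E]].
- intros x _; auto_derive; trivial; ring.
- intros x _; apply continuity_pt_filterlim, continuous_sin.
- rewrite sin_0, !Rminus_0_r in E; rewrite E.
  rewrite Rmin_left, Rmax_right in Hc by nra.
  assert (1 / 2 <= cos c) by (apply cos_ge_half; rewrite Rabs_pos_eq; nra).
  nra.
Qed.

Lemma tan_incr_le (x y : R) : - (PI / 2) < x -> x <= y -> y < PI / 2 -> tan x <= tan y.
Proof.
intros Hx [Hxy| ->] Hy; [left; apply tan_increasing|]; lra.
Qed.

(** Lets a clamped argument, which is closer to 0, be compared with the original one without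
    dividing by a cosine that may vanish. *)
Lemma sin_cos_monotone (x y : R) : Rabs x <= Rabs y -> Rabs y <= PI / 2 ->
  Rabs (sin x) <= Rabs (sin y) /\ cos y <= cos x.
Proof.
intros Hxy Hy.
assert (Hs : forall z, Rabs z <= PI / 2 -> Rabs (sin z) = sin (Rabs z)).
{ intros z Hz; unfold Rabs at 2; destruct (Rcase_abs z) as [Hz0|Hz0].
  - unfold Rabs in Hz; destruct (Rcase_abs z); [|lra].
    rewrite <- Rabs_Ropp, <- sin_neg; apply Rabs_pos_eq, sin_ge_0; lra.
  - rewrite Rabs_pos_eq in Hz by lra; apply Rabs_pos_eq, sin_ge_0; lra. }
assert (Hc : forall z, cos z = cos (Rabs z)).
{ intros z; unfold Rabs; destruct (Rcase_abs z); rewrite ?cos_neg; trivial. }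
pose proof (Rabs_pos x).
rewrite (Hs x), (Hs y), (Hc x), (Hc y) by lra.
split; [apply sin_incr_1|apply cos_decr_1]; lra.
Qed.

(* Kusmin-Landau: where [w] is at distance at least [eta] from the poles of
   [tan (PI * w)], the sums [u i + u (S i)] telescope against a monotone bounded
   factor; the remaining [i] are few since [w] is [delta]-separated. *)
Lemma vdc_block (u v w : nat -> R) (eta delta : R) (n : nat) :
  0 < eta <= 1 / 3 -> 0 < delta ->
  (forall i, Rabs (u i) <= 1) -> (forall i, Rabs (v i) <= 1) ->
  (forall i, (i <= n)%nat -> - (1 / 2) <= w i <= 1 / 2) ->
  (forall i, (i < n)%nat -> w (S i) + delta <= w i) ->
  (forall i, (i < n)%nat ->
     cos (PI * w i) * (u i + u (S i)) = sin (PI * w i) * (v (S i) - v i)) ->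
  Rabs (psum u (S n)) <= 5 + 2 / eta + 4 * (eta / delta).
Proof.
intros Heta Hdelta Hu Hv Hw Hgap Hid.
pose proof PI_RGT_0 as HPI.
set (b := 1 / 2 - eta).
(* Truncated at distance [eta] from the poles, the tangent stays monotone and is at most [1 / eta]
   in absolute value. *)
set (c := fun i => clamp (- b) b (w i)).
set (T := fun i => tan (PI * c i)).
assert (Hc : forall i, - b <= c i <= b) by (intros i; apply clamp_bounds; unfold b; lra).
assert (Hb : tan (PI * b) <= / eta).
{ unfold b; replace (PI * (1 / 2 - eta)) with (PI / 2 - PI * eta) by field.
  unfold tan; rewrite sin_shift, cos_shift.
  pose proof (sin_PI_mult_ge eta ltac:(lra)).
  pose proof (COS_bound (PI * eta)).
  apply (Rle_trans _ (1 / sin (PI * eta))).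
  - apply Rmult_le_compat_r; [left; apply Rinv_0_lt_compat|]; lra.
  - unfold Rdiv; rewrite Rmult_1_l; apply Rinv_le_contravar; lra. }
assert (HT : forall i, Rabs (T i) <= / eta).
{ intros i; apply Rabs_le; specialize (Hc i); unfold b in Hc.
  assert (tan (PI * c i) <= tan (PI * b)) by (apply tan_incr_le; unfold b; nra).
  assert (tan (- (PI * b)) <= tan (PI * c i)) by (apply tan_incr_le; unfold b; nra).
  rewrite tan_neg in *; unfold T; lra. }
assert (Hmain : Rabs (psum (fun i => (v (S i) - v i) * T i) n) <= 4 * / eta).
{ apply psum_abel_monotone; auto.
  - intros i Hi; specialize (Hgap i ltac:(lia)).
    pose proof (clamp_incr (- b) b (w (S i)) (w i) ltac:(lra)) as Hm.
    pose proof (Hc i); pose proof (Hc (S i)); unfold b in *.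
    apply tan_incr_le; [nra| |nra].
    apply Rmult_le_compat_l; [lra|exact Hm].
  - left; apply Rinv_0_lt_compat; lra. }
set (near := fun i => indic b (1 / 2) (w i) + indic (- (1 / 2)) (- b) (w i)).
assert (Herr : forall i, (i < n)%nat ->
   Rabs (u i + u (S i) - (v (S i) - v i) * T i) <= 4 * near i).
{ intros i Hi.
  specialize (Hid i Hi); pose proof (Hw i ltac:(lia)) as Hwi; specialize (Hc i).
  assert (Hcos : 0 < cos (PI * c i)) by (apply cos_gt_0; unfold b in Hc; nra).
  assert (HuS : Rabs (u i + u (S i)) <= 2).
  { eapply Rle_trans; [apply Rabs_triang|].
    pose proof (Hu i); pose proof (Hu (S i)); lra. }
  assert (Hnear : 1 <= near i \/ c i = w i /\ 0 <= near i).
  { unfold near, indic, c.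
    destruct (Rle_dec b (w i)), (Rle_dec (w i) (1 / 2)),
     (Rle_dec (- (1 / 2)) (w i)), (Rle_dec (w i) (- b)); try lra;
     right; rewrite clamp_id; lra. }
  destruct Hnear as [Hnear|[Hcw Hnear]].
  - apply (Rle_trans _ 4); [|lra].
    unfold Rminus at 1; eapply Rle_trans; [apply Rabs_triang|].
    rewrite Rabs_Ropp.
    (* Near a pole the truncated product still obeys the trivial bound: since [|c i| <= |w i|],
       [|sin (PI c)| |v' - v| <= |sin (PI w)| |v' - v| = cos (PI w) |u + u'| <= 2 cos (PI c)]. *)
    assert (Rabs ((v (S i) - v i) * T i) <= 2); [|lra].
    unfold T, tan.
    replace ((v (S i) - v i) * (sin (PI * c i) / cos (PI * c i)))
      with (sin (PI * c i) * (v (S i) - v i) / cos (PI * c i)) by (field; lra).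
    unfold Rdiv; rewrite Rabs_mult, (Rabs_pos_eq (/ _))
      by (left; apply Rinv_0_lt_compat; lra).
    apply (Rmult_le_reg_r (cos (PI * c i))); trivial.
    rewrite Rmult_assoc, Rinv_l, Rmult_1_r by lra.
    assert (Hcw : Rabs (c i) <= Rabs (w i)).
    { unfold c, clamp, b, Rmax, Rmin; destruct (Rle_dec _ (w i)), (Rle_dec _ _);
      unfold Rabs; repeat destruct Rcase_abs; lra. }
    destruct (sin_cos_monotone (PI * c i) (PI * w i)) as [Hs Hcos'].
    { rewrite !Rabs_mult, (Rabs_pos_eq PI) by lra; nra. }
    { rewrite Rabs_mult, (Rabs_pos_eq PI) by lra.
      assert (Rabs (w i) <= 1 / 2) by (apply Rabs_le; lra); nra. }
    assert (Hcos_w : 0 <= cos (PI * w i)) by (apply cos_ge_0; nra).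
    apply (f_equal Rabs) in Hid.
    rewrite !Rabs_mult, (Rabs_pos_eq (cos _)) in Hid by trivial.
    rewrite Rabs_mult.
    pose proof (Rabs_pos (v (S i) - v i)).
    pose proof (Rabs_pos (u i + u (S i))).
    apply (Rle_trans _ (cos (PI * w i) * Rabs (u i + u (S i)))); [rewrite Hid|]; nra.
  - replace (_ - _) with 0; [rewrite Rabs_R0; lra|].
    unfold T, tan; rewrite Hcw in *.
    apply (Rmult_eq_reg_l (cos (PI * w i))); [|lra].
    rewrite Rmult_minus_distr_l, Hid; field; lra. }
assert (Hcount : psum near n <= 2 * (eta / delta + 1)).
{ unfold near; rewrite psum_plus.
  pose proof (spaced_count w b (1 / 2) delta n ltac:(unfold b; lra) Hdelta Hgap) as H1.
  pose proof (spaced_count w (- (1 / 2)) (- b) delta n ltac:(unfold b; lra) Hdelta Hgap) as H2.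
  unfold b in *; replace (1 / 2 - (1 / 2 - eta)) with eta in H1 by ring.
  replace (- (1 / 2 - eta) - - (1 / 2)) with eta in H2 by ring; lra. }
assert (Hpair : Rabs (psum (fun i => u i + u (S i)) n) <= 4 * / eta + 8 * (eta / delta + 1)).
{ rewrite (psum_ext _ (fun i => (v (S i) - v i) * T i
            + (u i + u (S i) - (v (S i) - v i) * T i))) by (intros; ring).
  rewrite psum_plus; eapply Rle_trans; [apply Rabs_triang|].
  apply Rplus_le_compat; trivial.
  eapply Rle_trans; [apply psum_Rabs_le, Herr|].
  rewrite psum_scal; lra. }
(* Every term but the first and the last lies in two neighbouring pairs. Halving gives the final
   constants, with [5 = 4 + 1/2 + 1/2]. *)
assert (E : psum (fun i => u i + u (S i)) n = 2 * psum u (S n) - u O - u n).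
{ clear; induction n as [|n IH]; cbn [psum] in *; [ring|rewrite IH; ring]. }
rewrite E in Hpair.
pose proof (Hu O); pose proof (Hu n).
replace (psum u (S n)) with (/ 2 * (2 * psum u (S n) - u O - u n) + / 2 * u O + / 2 * u n) by field.
eapply Rle_trans; [apply Rabs_triang|].
eapply Rle_trans; [apply Rplus_le_compat_r, Rabs_triang|].
rewrite !Rabs_mult, (Rabs_pos_eq (/ 2)) by lra.
unfold Rdiv in *; lra.
Qed.

(** * The second derivative test for [(-1)^n n cos (PI y / n)] *)

(** Fourth roots turn the exponents 3/4 and 5/4 into integer powers, within reach of [field] and
    [nra]. *)
Definition root4 (x : R) : R := sqrt (sqrt x).

Lemma root4_pow (x : R) : 0 <= x -> root4 x ^ 4 = x.
Proof.
intros H; unfold root4; replace 4%nat with (2 * 2)%nat by reflexivity.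
rewrite pow_mult, (pow2_sqrt (sqrt x)), pow2_sqrt; auto using sqrt_pos.
Qed.

Lemma root4_ge_1 (x : R) : 1 <= x -> 1 <= root4 x.
Proof. intros H; unfold root4; rewrite <- sqrt_1, <- sqrt_1; now repeat apply sqrt_le_1_alt. Qed.

Lemma root4_incr (x y : R) : x <= y -> root4 x <= root4 y.
Proof. intros H; now repeat apply sqrt_le_1_alt. Qed.

Lemma INR_S_ge_1 (n : nat) : 1 <= INR (S n).
Proof. rewrite S_INR; pose proof (pos_INR n); lra. Qed.

(** Telescoping: for the fourth roots [a], [b] of consecutive integers,
    [(b - a) (a + b) (a^2 + b^2) = 1] and [b <= 2 a] give [1 / a^5 <= 30 (1 / a - 1 / b)], where
    [30 = 3 * 5 * 2]. *)
Lemma psum_inv_root4_pow5 (n : nat) :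
  psum (fun i => / root4 (INR (S i)) ^ 5) n <= 30.
Proof.
assert (H : psum (fun i => / root4 (INR (S i)) ^ 5) n <= 30 * (1 - / root4 (INR (S n)))).
{ induction n as [|n IH].
  - simpl; unfold root4; rewrite !sqrt_1; lra.
  - cbn [psum].
    pose proof (root4_ge_1 _ (INR_S_ge_1 n)) as Ha.
    pose proof (root4_incr (INR (S n)) (INR (S (S n))) ltac:(rewrite (S_INR (S n)); lra)) as Hab.
    pose proof (root4_pow _ (pos_INR (S n))) as Ha4.
    pose proof (root4_pow _ (pos_INR (S (S n)))) as Hb4.
    rewrite (S_INR (S n)) in *.
    set (a := root4 (INR (S n))) in *; set (b := root4 (INR (S n) + 1)) in *.
    clearbody a b; rewrite <- Ha4 in Hb4.
    assert (Hb : b <= 2 * a).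
    { destruct (Rle_lt_dec b (2 * a)) as [|Hlt]; trivial; exfalso.
      assert ((2 * a) ^ 4 <= b ^ 4) by (apply pow_incr; lra).
      assert (1 <= a ^ 4) by (apply pow_R1_Rle; lra).
      nra. }
    assert (Hd : 1 <= (b - a) * (15 * a ^ 3)).
    { replace 1 with ((b - a) * ((a + b) * (a ^ 2 + b ^ 2))) by nra.
      apply Rmult_le_compat_l; [lra|].
      apply (Rle_trans _ ((3 * a) * (5 * a ^ 2))); [|nra].
      apply Rmult_le_compat; nra. }
    assert (H : / a ^ 5 <= 30 * (/ a - / b)); [|lra].
    replace (30 * (/ a - / b)) with (30 * (b - a) * / (a * b)) by (field; lra).
    apply (Rmult_le_reg_r (a ^ 5 * b)).
    { apply Rmult_lt_0_compat; [apply pow_lt|]; lra. }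
    replace (/ a ^ 5 * (a ^ 5 * b)) with b by (field; lra).
    replace (30 * (b - a) * / (a * b) * (a ^ 5 * b)) with (2 * a * ((b - a) * (15 * a ^ 3)))
      by (field; lra).
    nra. }
pose proof (Rinv_0_lt_compat _ (Rlt_le_trans _ _ _ Rlt_0_1 (root4_ge_1 _ (INR_S_ge_1 n)))).
lra.
Qed.

(** Abel summation: increasing weights cost at most twice the last of them. *)
Lemma psum_weighted (f : nat -> R) (B : R) (q n : nat) :
  (forall j, (j <= n)%nat -> Rabs (psum f j) <= B) ->
  Rabs (psum (fun i => INR (S (q + i)) * f i) n) <= 2 * INR (q + n) * B.
Proof.
intros H.
assert (E : psum (fun i => INR (S (q + i)) * f i) n
            = INR (q + n) * psum f n - psum (psum f) n).
{ clear; induction n as [|n IH]; [simpl; ring|].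
  cbn [psum]; rewrite IH, Nat.add_succ_r, S_INR; ring. }
assert (H1 : Rabs (psum (psum f) n) <= INR n * B).
{ rewrite <- psum_const; apply psum_Rabs_le; intros i Hi; apply H; lia. }
assert (H2 : Rabs (INR (q + n) * psum f n) <= INR (q + n) * B).
{ rewrite Rabs_mult, (Rabs_pos_eq _ (pos_INR _)).
  apply Rmult_le_compat_l; [apply pos_INR|apply H; lia]. }
assert (H0 : 0 <= B) by (eapply Rle_trans; [apply Rabs_pos|apply (H O); lia]).
rewrite E; unfold Rminus; eapply Rle_trans; [apply Rabs_triang|].
rewrite Rabs_Ropp; rewrite plus_INR in *; pose proof (pos_INR q); nra.
Qed.

(** Applied to the decreasing slopes, it shows that each block is an interval of indices. *)
Lemma antitone_cut (w : nat -> R) (c : R) (n : nat) :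
  (forall i, w (S i) <= w i) ->
  exists q, (q <= n)%nat /\ (forall i, (i < q)%nat -> c <= w i) /\
    (forall i, (q <= i < n)%nat -> w i < c).
Proof.
intros Hw; induction n as [|n [q [Hq [H1 H2]]]].
- exists O; repeat split; intros; lia.
- destruct (Rle_lt_dec c (w n)) as [H|H].
  + exists (S n); repeat split; [lia| |lia].
    intros i Hi; apply (Rle_trans _ (w n)); trivial.
    assert (Hm : forall k, w (i + k)%nat <= w i).
    { induction k as [|k IHk]; [rewrite Nat.add_0_r; lra|].
      rewrite Nat.add_succ_r; eapply Rle_trans; [apply Hw|exact IHk]. }
    replace n with (i + (n - i))%nat by lia; apply Hm.
  + exists q; repeat split; [lia|exact H1|].
    intros i Hi; destruct (Nat.eq_dec i n) as [->|]; [exact H|apply H2; lia].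
Qed.

(** * Phases of consecutive terms *)

Lemma cos_add_INR_PI (x : R) (k : nat) : cos (x + INR k * PI) = (-1) ^ k * cos x.
Proof.
induction k as [|k IH]; [simpl; rewrite Rmult_0_l, Rplus_0_r; ring|].
rewrite S_INR; replace (x + (INR k + 1) * PI) with (x + INR k * PI + PI) by ring.
rewrite neg_cos, IH; simpl; ring.
Qed.

Lemma sin_add_INR_PI (x : R) (k : nat) : sin (x + INR k * PI) = (-1) ^ k * sin x.
Proof.
induction k as [|k IH]; [simpl; rewrite Rmult_0_l, Rplus_0_r; ring|].
rewrite S_INR; replace (x + (INR k + 1) * PI) with (x + INR k * PI + PI) by ring.
rewrite neg_sin, IH; simpl; ring.
Qed.

Lemma Rabs_sign_mult (k : nat) (x : R) : Rabs ((-1) ^ k * x) = Rabs x.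
Proof. rewrite Rabs_mult, pow_1_abs; ring. Qed.

(** Real part ([h = cos]) or imaginary part ([h = sin]) of the term for [n = S i]; in terms of [n]
    the sign is [(-1)^(n - 1)]. *)
Definition osc (h : R -> R) (y : R) (i : nat) : R :=
  (-1) ^ i * h (PI * (y / INR (S i))).

(** Half of [y / n - y / (n + 1)] at [n = S i]. *)
Definition slope (y : R) (i : nat) : R := y / (2 * INR (S i) * INR (S (S i))).

(** Sum-to-product formulas around the midpoint [m] of the two phases: both sides share the factor
    [sin m]. Subtracting the integer [r] changes both sides by the same sign; it serves to move the
    slope into the central period of the tangent. *)
Lemma osc_slope (y : R) (i r : nat) :
  cos (PI * (slope y i - INR r)) * (osc cos y i + osc cos y (S i)) =
  sin (PI * (slope y i - INR r)) * (osc sin y (S i) - osc sin y i).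
Proof.
replace (PI * slope y i) with (PI * (slope y i - INR r) + INR r * PI) by ring.
assert (H : cos (PI * slope y i) * (osc cos y i + osc cos y (S i)) =
            sin (PI * slope y i) * (osc sin y (S i) - osc sin y i)).
{ unfold osc, slope.
  pose proof (INR_S_ge_1 i) as Hi; rewrite (S_INR (S i)).
  set (n := INR (S i)) in *.
  set (m := PI * (y / n) - PI * (y / (2 * n * (n + 1)))).
  replace (PI * (y / n)) with (m + PI * (y / (2 * n * (n + 1)))) by (unfold m; ring).
  replace (PI * (y / (n + 1))) with (m - PI * (y / (2 * n * (n + 1)))) by (unfold m; field; lra).
  rewrite cos_plus, cos_minus, sin_plus, sin_minus; simpl; ring. }
replace (PI * slope y i) with (PI * (slope y i - INR r) + INR r * PI) in H by ring.
rewrite cos_add_INR_PI, sin_add_INR_PI, !Rmult_assoc in H.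
apply Rmult_eq_reg_l in H; trivial.
apply pow_nonzero; lra.
Qed.

(** Plays the role of the second derivative of the phase. *)
Lemma slope_gap (y : R) (i : nat) :
  slope y i - slope y (S i) = y / (INR (S i) * (INR (S i) + 1) * (INR (S i) + 2)).
Proof.
unfold slope; rewrite (S_INR (S (S i))), (S_INR (S i)); pose proof (INR_S_ge_1 i).
field; lra.
Qed.

(* Here [delta] bounds the gaps of [slope] on the block from below, and
   [eta = delta^(1/2)] up to a constant balances [1 / eta] against [eta / delta]. *)
Lemma osc_cos_block (g : R) (r q n : nat) :
  1 <= g -> INR (S r) <= g ->
  (forall i, (q <= i < q + n)%nat -> - (1 / 2) <= slope (g ^ 4) i - INR r <= 1 / 2) ->
  INR (q + n) ^ 2 * INR (S r) <= 2 * g ^ 4 ->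
  Rabs (psum (fun i => INR (S (q + i)) * osc cos (g ^ 4) (q + i)) n)
   <= 99 * g ^ 3 * / root4 (INR (S r)) ^ 5.
Proof.
intros Hg Hr Hw HN.
pose proof (root4_ge_1 _ (INR_S_ge_1 r)) as Ha.
pose proof (root4_pow _ (pos_INR (S r))) as Ha4.
set (a := root4 (INR (S r))) in *; clearbody a.
rewrite <- Ha4 in HN, Hr.
assert (Hga : a ^ 3 <= g) by (apply (Rle_trans _ (a ^ 4)); trivial; simpl; nra).
assert (Ha3 : 1 <= a ^ 3) by (apply pow_R1_Rle; lra).
assert (HQ : INR (q + n) * a ^ 2 <= 3 / 2 * g ^ 2).
{ apply Rsqr_incr_0_var; unfold Rsqr; [|nra].
  replace (INR (q + n) * a ^ 2 * (INR (q + n) * a ^ 2)) with (INR (q + n) ^ 2 * a ^ 4) by ring.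
  replace (3 / 2 * g ^ 2 * (3 / 2 * g ^ 2)) with (9 / 4 * g ^ 4) by field.
  assert (0 <= g ^ 4) by (apply pow_le; lra); lra. }
(* A gap is at least [g^4 / (6 m^3)] with [m <= 3/2 g^2 / a^2], and [6 * 27 / 8 <= 24]. Then
   [2 / eta = 16 g / a^3] and [4 * (eta / delta) = 12 g / a^3], whence [33 = 5 + 16 + 12] below. *)
set (eta := a ^ 3 / (8 * g)); set (delta := a ^ 6 / (24 * g ^ 2)).
assert (Hd : 0 < delta).
{ apply Rdiv_lt_0_compat; [apply pow_lt; lra|nra]. }
assert (He : 0 < eta <= 1 / 3).
{ split; [apply Rdiv_lt_0_compat; lra|].
  apply (Rmult_le_reg_r (8 * g)); [lra|].
  unfold eta; replace (a ^ 3 / (8 * g) * (8 * g)) with (a ^ 3) by (field; lra); lra. }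
assert (Hb : forall j, (j <= n)%nat ->
   Rabs (psum (fun i => osc cos (g ^ 4) (q + i)) j) <= 33 * (g / a ^ 3)).
{ assert (H1 : 1 <= g / a ^ 3).
  { apply (Rmult_le_reg_r (a ^ 3)); [lra|].
    replace (g / a ^ 3 * a ^ 3) with g by (field; lra); lra. }
  intros [|j] Hj; [cbn [psum]; rewrite Rabs_R0; lra|].
  apply (Rle_trans _ (5 + 2 / eta + 4 * (eta / delta))).
  - apply (vdc_block _ (fun i => osc sin (g ^ 4) (q + i))
      (fun i => slope (g ^ 4) (q + i) - INR r)); trivial.
    + intros i; unfold osc; rewrite Rabs_sign_mult; apply Rabs_le, COS_bound.
    + intros i; unfold osc; rewrite Rabs_sign_mult; apply Rabs_le, SIN_bound.
    + intros i Hi; apply Hw; lia.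
    + intros i Hi; rewrite Nat.add_succ_r.
      pose proof (slope_gap (g ^ 4) (q + i)) as Hgap.
      assert (delta <= slope (g ^ 4) (q + i) - slope (g ^ 4) (S (q + i))); [|lra].
      rewrite Hgap.
      pose proof (INR_S_ge_1 (q + i)) as H1m.
      assert (HmN : INR (S (q + i)) <= INR (q + n)) by (apply le_INR; lia).
      set (m := INR (S (q + i))) in *; clearbody m.
      assert (Hm : m * a ^ 2 <= 3 / 2 * g ^ 2).
      { eapply Rle_trans; [|exact HQ]; apply Rmult_le_compat_r; [nra|lra]. }
      assert (Hm3 : m ^ 3 * a ^ 6 <= 27 / 8 * g ^ 6).
      { replace (m ^ 3 * a ^ 6) with ((m * a ^ 2) ^ 3) by ring.
        replace (27 / 8 * g ^ 6) with ((3 / 2 * g ^ 2) ^ 3) by field.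
        apply pow_incr; nra. }
      assert (Hm0 : 0 < m * (m + 1) * (m + 2)) by (repeat apply Rmult_lt_0_compat; lra).
      assert (Hm6 : m * (m + 1) * (m + 2) <= 6 * m ^ 3) by nra.
      assert (Ha6 : 0 < a ^ 6) by (apply pow_lt; lra).
      unfold delta; apply (Rmult_le_reg_r (24 * g ^ 2 * (m * (m + 1) * (m + 2)))).
      { apply Rmult_lt_0_compat; nra. }
      replace (a ^ 6 / (24 * g ^ 2) * (24 * g ^ 2 * (m * (m + 1) * (m + 2))))
        with (a ^ 6 * (m * (m + 1) * (m + 2))) by (field; lra).
      replace (g ^ 4 / (m * (m + 1) * (m + 2)) * (24 * g ^ 2 * (m * (m + 1) * (m + 2))))
        with (24 * g ^ 6) by (field; lra).
      nra.
    + intros i Hi; rewrite Nat.add_succ_r; apply osc_slope.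
  - replace (2 / eta) with (16 * (g / a ^ 3)) by (unfold eta; field; lra).
    replace (eta / delta) with (3 * (g / a ^ 3)) by (unfold eta, delta; field; lra).
    lra. }
apply psum_weighted with (q := q) in Hb.
eapply Rle_trans; [exact Hb|].
replace (2 * INR (q + n) * (33 * (g / a ^ 3)))
  with (66 * g * / a ^ 5 * (INR (q + n) * a ^ 2)) by (field; lra).
replace (99 * g ^ 3 * / a ^ 5) with (66 * g * / a ^ 5 * (3 / 2 * g ^ 2)) by (field; lra).
apply Rmult_le_compat_l; trivial.
apply Rmult_le_pos; [lra|left; apply Rinv_0_lt_compat, pow_lt; lra].
Qed.

(** Here [2972 = 99 * 30 + 2]: the block bounds summed over [r], plus the trivial bound for the
    terms of largest slope. *)
Lemma osc_cos_sum (g : R) (N : nat) :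
  1 <= g -> INR N ^ 2 <= g ^ 4 ->
  Rabs (psum (fun i => INR (S i) * osc cos (g ^ 4) i) N) <= 2972 * g ^ 3.
Proof.
intros Hg HN.
set (F := fun i => INR (S i) * osc cos (g ^ 4) i).
assert (Hg4 : 1 <= g ^ 4) by (apply pow_R1_Rle; lra).
destruct (nfloor_ex g ltac:(lra)) as [Rm HR].
assert (HR1 : 1 <= INR Rm).
{ destruct Rm; [simpl in HR; lra|apply INR_S_ge_1]. }
assert (Hle : forall i, slope (g ^ 4) i * (2 * INR (S i) ^ 2) <= g ^ 4).
{ intros i; unfold slope; rewrite (S_INR (S i)); pose proof (INR_S_ge_1 i).
  set (m := INR (S i)) in *.
  replace (g ^ 4 / (2 * m * (m + 1)) * (2 * m ^ 2)) with (g ^ 4 * (m / (m + 1))) by (field; lra).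
  rewrite <- (Rmult_1_r (g ^ 4)) at 2; apply Rmult_le_compat_l; [lra|].
  apply (Rmult_le_reg_r (m + 1)); [lra|].
  replace (m / (m + 1) * (m + 1)) with m by (field; lra); lra. }
assert (Hdecr : forall i, slope (g ^ 4) (S i) <= slope (g ^ 4) i).
{ intros i; pose proof (slope_gap (g ^ 4) i); pose proof (INR_S_ge_1 i).
  assert (0 <= g ^ 4 / (INR (S i) * (INR (S i) + 1) * (INR (S i) + 2))); [|lra].
  apply Rdiv_le_0_compat; [lra|]; repeat apply Rmult_lt_0_compat; lra. }
assert (Hpos : forall i, 0 <= slope (g ^ 4) i).
{ intros i; unfold slope; pose proof (INR_S_ge_1 i); pose proof (INR_S_ge_1 (S i)).
  apply Rdiv_le_0_compat; nra. }
(* The block of [r] consists of the [i] with [|slope i - r| <= 1/2]; the indices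
   beyond the blocks [r < Rm] are so few that the trivial bound suffices. *)
assert (H : forall j r M, (r + j = Rm)%nat -> INR M ^ 2 <= g ^ 4 ->
   (forall i, (i < M)%nat -> INR r - 1 / 2 <= slope (g ^ 4) i) ->
   Rabs (psum F M) <=
     psum (fun i => 99 * g ^ 3 * / root4 (INR (S (r + i))) ^ 5) j + 2 * g ^ 3).
(* Induction on the number [j] of blocks left; block [r] is cut off at the large indices, and [M] is
   the length of the sum still to be treated. *)
{ induction j as [|j IH]; intros r M Hr HM Hw.
  - rewrite Nat.add_0_r in Hr; subst r; simpl psum at 2; rewrite Rplus_0_l.
    apply (Rle_trans _ (INR M * INR M)).
    { rewrite <- psum_const; apply psum_Rabs_le; intros i Hi; unfold F, osc.
      rewrite Rabs_mult, Rabs_sign_mult, (Rabs_pos_eq _ (pos_INR _)).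
      assert (Rabs (cos (PI * (g ^ 4 / INR (S i)))) <= 1) by apply Rabs_le, COS_bound.
      assert (INR (S i) <= INR M) by (apply le_INR; lia).
      pose proof (pos_INR (S i)); pose proof (Rabs_pos (cos (PI * (g ^ 4 / INR (S i))))); nra. }
    destruct M as [|M]; [cbn [INR]; rewrite Rmult_0_l; pose proof (pow_lt g 3 ltac:(lra)); lra|].
    specialize (Hle M); specialize (Hw M ltac:(lia)).
    pose proof (INR_S_ge_1 M); set (m := INR (S M)) in *; clearbody m.
    (* [Rm > g - 1] and [Rm >= 1] give [Rm - 1 / 2 >= g / 4]; hence [m^2 <= 2 g^3]. *)
    assert (g / 4 <= slope (g ^ 4) M) by lra.
    assert (g / 4 * (2 * m ^ 2) <= g ^ 4) by nra.
    apply (Rmult_le_reg_l (g / 2)); [lra|].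
    replace (g / 2 * (2 * g ^ 3)) with (g ^ 4) by field; nra.
  - destruct (antitone_cut (slope (g ^ 4)) (INR r + 1 / 2) M Hdecr) as [q [Hq [H1 H2]]].
    replace M with (q + (M - q))%nat at 1 by lia.
    rewrite psum_add; eapply Rle_trans; [apply Rabs_triang|].
    assert (Hlow : Rabs (psum F q) <=
      psum (fun i => 99 * g ^ 3 * / root4 (INR (S (S r + i))) ^ 5) j + 2 * g ^ 3).
    { apply IH; [lia| |].
      - eapply Rle_trans; [|exact HM].
        apply pow_incr; split; [apply pos_INR|apply le_INR; lia].
      - intros i Hi; rewrite S_INR; specialize (H1 i Hi); lra. }
    assert (Hblock : Rabs (psum (fun i => F (q + i)%nat) (M - q))
              <= 99 * g ^ 3 * / root4 (INR (S r)) ^ 5).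
    { apply osc_cos_block; trivial.
      - apply (Rle_trans _ (INR Rm)); [apply le_INR; lia|lra].
      - intros i Hi; specialize (Hw i ltac:(lia)); specialize (H2 i ltac:(lia)); lra.
      - replace (q + (M - q))%nat with M by lia.
        destruct M as [|M]; [simpl; lra|].
        specialize (Hle M); specialize (Hw M ltac:(lia)).
        (* For [r = 0] the lower bound on the slope gives no information, and [M^2 <= g^4] is used;
           for [r >= 1], [r + 1 <= 4 (r - 1 / 2)]. *)
        destruct r as [|r]; [simpl INR at 2; lra|].
        pose proof (INR_S_ge_1 r); rewrite (S_INR (S r)).
        set (m := INR (S M)) in *; set (t := INR (S r)) in *.
        assert ((t - 1 / 2) * (2 * m ^ 2) <= g ^ 4) by nra.
        nra. }
    rewrite psum_succ_l, Nat.add_0_r.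
    rewrite (psum_ext (fun i => 99 * g ^ 3 * / root4 (INR (S (r + S i))) ^ 5)
               (fun i => 99 * g ^ 3 * / root4 (INR (S (S r + i))) ^ 5)); [lra|].
    intros i _; rewrite Nat.add_succ_r; reflexivity. }
eapply Rle_trans; [apply (H Rm O N); trivial|].
- intros i _; cbn [INR]; specialize (Hpos i); lra.
- rewrite psum_scal; pose proof (psum_inv_root4_pow5 Rm) as Hs.
  apply (Rmult_le_compat_l (99 * g ^ 3)) in Hs; [simpl Nat.add; lra|].
  pose proof (pow_lt g 3 ltac:(lra)); lra.
Qed.

(** * Fourier series of the triangular wave *)

Definition odd_freq (j : nat) : R := INR (2 * j + 1).

Lemma odd_freq_eq (j : nat) : odd_freq j = 2 * INR j + 1.
Proof. unfold odd_freq; rewrite plus_INR, mult_INR; simpl; ring. Qed.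

Lemma odd_freq_ge_1 (j : nat) : 1 <= odd_freq j.
Proof. rewrite odd_freq_eq; pose proof (pos_INR j); lra. Qed.

Definition cos_sum (J : nat) (t : R) : R :=
  psum (fun j => cos (odd_freq j * t) / odd_freq j ^ 2) J.

(** Minus the derivative of [cos_sum]: partial sums of a square wave, equal to [PI / 4] on [(0, PI)]
    in the limit. *)
Definition sin_sum (J : nat) (t : R) : R :=
  psum (fun j => sin (odd_freq j * t) / odd_freq j) J.

Lemma is_derive_psum (f df : nat -> R -> R) (x : R) (n : nat) :
  (forall i, is_derive (f i) x (df i x)) ->
  is_derive (fun t => psum (fun i => f i t) n) x (psum (fun i => df i x) n).
Proof.
intros H; induction n as [|n IH]; simpl.
- apply (is_derive_const (K := R_AbsRing) (V := R_NormedModule) 0).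
- apply (is_derive_plus (K := R_AbsRing) (V := R_NormedModule)); trivial.
Qed.

Lemma is_derive_cos_sum (J : nat) (t : R) : is_derive (cos_sum J) t (- sin_sum J t).
Proof.
unfold cos_sum, sin_sum.
replace (- psum (fun j => sin (odd_freq j * t) / odd_freq j) J)
  with (psum (fun j => - (sin (odd_freq j * t) / odd_freq j)) J).
- apply (is_derive_psum (fun j t => cos (odd_freq j * t) / odd_freq j ^ 2)
    (fun j t => - (sin (odd_freq j * t) / odd_freq j))).
  intros j; pose proof (odd_freq_ge_1 j); auto_derive; [trivial|field; lra].
- rewrite (psum_ext _ (fun j => -1 * (sin (odd_freq j * t) / odd_freq j))) by (intros; ring).
  rewrite psum_scal; ring.
Qed.

Lemma dirichlet_kernel (J : nat) (t : R) :
  2 * sin t * psum (fun j => cos (odd_freq j * t)) J = sin (2 * INR J * t).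
Proof.
induction J as [|J IH]; [simpl; replace (2 * 0 * t) with 0 by ring; rewrite sin_0; ring|].
cbn [psum]; rewrite Rmult_plus_distr_l, IH, odd_freq_eq, S_INR.
replace ((2 * INR J + 1) * t) with (2 * INR J * t + t) by ring.
replace (2 * (INR J + 1) * t) with (2 * INR J * t + t + t) by ring.
rewrite (sin_plus (2 * INR J * t + t)), sin_plus, cos_plus.
pose proof (sin2_cos2 t) as H; unfold Rsqr in H.
replace (sin (2 * INR J * t)) with (sin (2 * INR J * t) * (sin t * sin t + cos t * cos t)) at 1
  by (rewrite H; ring).
ring.
Qed.

Lemma is_derive_sin_sum (J : nat) (t : R) :
  0 < sin t -> is_derive (sin_sum J) t (sin (2 * INR J * t) / (2 * sin t)).
Proof.
intros Ht; rewrite <- dirichlet_kernel.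
replace (2 * sin t * _ / _) with (psum (fun j => cos (odd_freq j * t)) J) by (field; lra).
apply (is_derive_psum (fun j t => sin (odd_freq j * t) / odd_freq j)
    (fun j t => cos (odd_freq j * t))).
intros j; pose proof (odd_freq_ge_1 j); auto_derive; [trivial|field; lra].
Qed.

Lemma derive_bound (f df : R -> R) (M a b : R) :
  (forall x, Rmin a b <= x <= Rmax a b -> is_derive f x (df x)) ->
  (forall x, Rmin a b <= x <= Rmax a b -> Rabs (df x) <= M) ->
  Rabs (f b - f a) <= M * Rabs (b - a).
Proof.
intros Hd HM.
destruct (MVT_gen f a b df) as [c [Hc E]].
- intros x Hx; apply Hd; lra.
- intros x Hx; apply continuity_pt_filterlim.
  apply (ex_derive_continuous (K := R_AbsRing) (V := R_NormedModule)).
  exists (df x); auto.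
- rewrite E, Rabs_mult; apply Rmult_le_compat_r; [apply Rabs_pos|auto].
Qed.

Lemma sin_ge_between (t u : R) :
  0 < t < PI -> Rmin (PI / 2) t <= u <= Rmax (PI / 2) t -> sin t <= sin u.
Proof.
intros Ht Hu; destruct (Rle_dec t (PI / 2)) as [H|H].
- rewrite Rmin_right, Rmax_left in Hu by lra; apply sin_incr_1; lra.
- rewrite Rmin_left, Rmax_right in Hu by lra; apply sin_decr_1; lra.
Qed.

Lemma between_dist (t u : R) :
  0 < t < PI -> Rmin (PI / 2) t <= u <= Rmax (PI / 2) t -> Rabs (u - PI / 2) <= PI / 2.
Proof.
unfold Rmin, Rmax; destruct (Rle_dec (PI / 2) t); intros; apply Rabs_le; lra.
Qed.

(* [sin_sum J] plus the correction [cos (2 J u) / (4 J sin u)] has derivative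
   [- cos (2 J u) cos u / (4 J sin^2 u)]: one integration by parts against the
   Dirichlet kernel. *)
Lemma sin_sum_close (J : nat) (t u : R) :
  0 < t < PI -> Rmin (PI / 2) t <= u <= Rmax (PI / 2) t ->
  Rabs (sin_sum (S J) u - sin_sum (S J) (PI / 2)) <= / INR (S J) * / sin t ^ 2.
Proof.
intros Ht Hu; pose proof (INR_S_ge_1 J) as HJ; set (K := S J) in *.
assert (Hst : 0 < sin t) by (apply sin_gt_0; lra).
assert (Hs1 : sin t <= 1) by apply SIN_bound.
set (M := / (4 * INR K) * / sin t ^ 2).
assert (HM : 0 < / (4 * INR K)) by (apply Rinv_0_lt_compat; lra).
set (corr := fun v => cos (2 * INR K * v) / (4 * INR K * sin v)).
assert (Hcorr : forall v, sin t <= sin v -> Rabs (corr v) <= M).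
{ intros v Hv; unfold corr, M.
  replace (cos (2 * INR K * v) / (4 * INR K * sin v))
    with (/ (4 * INR K) * (cos (2 * INR K * v) * / sin v)) by (field; lra).
  rewrite Rabs_mult, Rabs_pos_eq by lra; apply Rmult_le_compat_l; [lra|].
  rewrite Rabs_mult, (Rabs_pos_eq (/ sin v)) by (left; apply Rinv_0_lt_compat; lra).
  assert (Rabs (cos (2 * INR K * v)) <= 1) by apply Rabs_le, COS_bound.
  assert (/ sin v <= / sin t ^ 2) by (apply Rinv_le_contravar; nra).
  assert (0 < / sin v) by (apply Rinv_0_lt_compat; lra).
  nra. }
assert (Hmid : sin t <= sin (PI / 2)) by (rewrite sin_PI2; lra).
assert (Hsu : sin t <= sin u) by (apply sin_ge_between; trivial).
assert (H : Rabs (sin_sum K u + corr u - (sin_sum K (PI / 2) + corr (PI / 2)))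
            <= M * Rabs (u - PI / 2)).
{ assert (Hsub : forall x, Rmin (PI / 2) u <= x <= Rmax (PI / 2) u -> sin t <= sin x).
  { intros x Hx; apply sin_ge_between; trivial.
    revert Hu Hx; unfold Rmin, Rmax.
    destruct (Rle_dec (PI / 2) t), (Rle_dec (PI / 2) u); lra. }
  apply (derive_bound (fun v => sin_sum K v + corr v)
    (fun v => - (/ (4 * INR K) * (cos (2 * INR K * v) * cos v * / sin v ^ 2)))).
  - intros x Hx; specialize (Hsub x Hx).
    replace (- _) with (plus (sin (2 * INR K * x) / (2 * sin x))
       (- (sin (2 * INR K * x) / (2 * sin x))
        - / (4 * INR K) * (cos (2 * INR K * x) * cos x * / sin x ^ 2)))
      by (unfold plus; simpl; ring).
    apply (is_derive_plus (K := R_AbsRing) (V := R_NormedModule)).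
    + apply is_derive_sin_sum; lra.
    + unfold corr; revert HJ; generalize (INR K); intros k Hk; auto_derive; [|field; lra].
      apply Rmult_integral_contrapositive; split; [lra|apply Rgt_not_eq; lra].
  - intros x Hx; specialize (Hsub x Hx); unfold M.
    rewrite Rabs_Ropp, Rabs_mult, Rabs_pos_eq by lra.
    apply Rmult_le_compat_l; [lra|].
    rewrite Rabs_mult, (Rabs_pos_eq (/ _)) by (left; apply Rinv_0_lt_compat; nra).
    assert (Rabs (cos (2 * INR K * x) * cos x) <= 1).
    { rewrite Rabs_mult.
      assert (Rabs (cos (2 * INR K * x)) <= 1) by apply Rabs_le, COS_bound.
      assert (Rabs (cos x) <= 1) by apply Rabs_le, COS_bound.
      pose proof (Rabs_pos (cos x)); pose proof (Rabs_pos (cos (2 * INR K * x))); nra. }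
    assert (/ sin x ^ 2 <= / sin t ^ 2) by (apply Rinv_le_contravar; nra).
    assert (0 < / sin x ^ 2) by (apply Rinv_0_lt_compat; nra).
    nra. }
pose proof (between_dist t u Ht Hu) as Hdist.
pose proof (Hcorr _ Hsu) as H1; pose proof (Hcorr _ Hmid) as H2.
assert (HMpos : 0 < M).
{ unfold M; apply Rmult_lt_0_compat; [lra|apply Rinv_0_lt_compat; nra]. }
(* Two corrections of size [M], and [M] times a distance at most [PI / 2 <= 2], add up to
   [4 * M]. *)
assert (HMd : M * Rabs (u - PI / 2) <= M * 2).
{ apply Rmult_le_compat_l; [lra|]; pose proof PI_4; lra. }
replace (/ INR K * / sin t ^ 2) with (4 * M) by (unfold M; field; lra).
apply Rabs_le_between in H, H1, H2; apply Rabs_le; lra.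
Qed.

(** At [PI / 2] the sines alternate in sign, and the sum is Leibniz's series. *)
Lemma is_lim_seq_sin_sum_mid : is_lim_seq (fun J => sin_sum J (PI / 2)) (PI / 4).
Proof.
apply is_lim_seq_incr_1.
pose proof Alt_PI_eq as E; unfold Alt_PI in E; destruct exist_PI as [l Hl].
replace (PI / 4) with l by lra.
apply is_lim_seq_Reals in Hl; revert Hl; apply is_lim_seq_ext; intros n.
unfold sin_sum.
transitivity (psum (tg_alt PI_tg) (S n)).
- induction n as [|n IH]; [simpl; ring|].
  cbn [sum_f_R0]; rewrite IH; reflexivity.
- apply psum_ext; intros i _; unfold tg_alt, PI_tg.
  replace (odd_freq i * (PI / 2)) with (PI / 2 + INR i * PI) by (rewrite odd_freq_eq; field).
  rewrite sin_add_INR_PI, sin_PI2; unfold odd_freq, Rdiv; ring.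
Qed.

Lemma cos_sum_mid (J : nat) : cos_sum J (PI / 2) = 0.
Proof.
unfold cos_sum; rewrite (psum_ext _ (fun _ => 0)); [rewrite psum_const; ring|].
intros j _; replace (odd_freq j * (PI / 2)) with (PI / 2 + INR j * PI)
  by (rewrite odd_freq_eq; field).
rewrite cos_add_INR_PI, cos_PI2; unfold Rdiv; ring.
Qed.

(** [cos_sum] vanishes at [PI / 2], and between [PI / 2] and [t] its derivative is uniformly close
    to [- PI / 4]; the mean value theorem carries this to [t]. *)
Lemma is_lim_seq_cos_sum_open (t : R) : 0 < t < PI ->
  is_lim_seq (fun J => cos_sum J t) (PI ^ 2 / 8 - PI * t / 4).
Proof.
intros Ht; apply is_lim_seq_incr_1.
set (e := fun J => / INR (S J) * / sin t ^ 2 + Rabs (sin_sum (S J) (PI / 2) - PI / 4)).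
assert (He : is_lim_seq e 0).
{ replace (Finite 0) with (Finite (0 * / sin t ^ 2 + Rabs (PI / 4 - PI / 4)))
    by (rewrite Rminus_diag, Rabs_R0; f_equal; ring).
  apply is_lim_seq_plus'.
  - apply (is_lim_seq_scal_r _ _ 0).
    apply (is_lim_seq_incr_1 (fun n => / INR n)).
    apply (is_lim_seq_inv INR p_infty); [apply is_lim_seq_INR|discriminate].
  - apply (is_lim_seq_abs _ (PI / 4 - PI / 4)), is_lim_seq_minus'; [|apply is_lim_seq_const].
    apply (is_lim_seq_incr_1 (fun J => sin_sum J (PI / 2))), is_lim_seq_sin_sum_mid. }
assert (H : forall J, Rabs (cos_sum (S J) t - (PI ^ 2 / 8 - PI * t / 4)) <= e J * 2).
{ intros J.
  replace (cos_sum (S J) t - (PI ^ 2 / 8 - PI * t / 4))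
    with (cos_sum (S J) t + PI / 4 * t - (cos_sum (S J) (PI / 2) + PI / 4 * (PI / 2)))
    by (rewrite cos_sum_mid; field).
  apply (Rle_trans _ (e J * Rabs (t - PI / 2))).
  - apply (derive_bound (fun u => cos_sum (S J) u + PI / 4 * u)
      (fun u => - sin_sum (S J) u + PI / 4)).
    + intros u Hu; apply (is_derive_plus (K := R_AbsRing) (V := R_NormedModule)).
      * apply is_derive_cos_sum.
      * auto_derive; [trivial|ring].
    + intros u Hu; unfold e.
      replace (- sin_sum (S J) u + PI / 4) with
        (- (sin_sum (S J) u - sin_sum (S J) (PI / 2))
         + - (sin_sum (S J) (PI / 2) - PI / 4)) by ring.
      eapply Rle_trans; [apply Rabs_triang|]; rewrite !Rabs_Ropp.
      apply Rplus_le_compat_r, sin_sum_close; trivial.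
  - apply Rmult_le_compat_l.
    + unfold e; apply Rplus_le_le_0_compat; [|apply Rabs_pos].
      apply Rmult_le_pos; left; apply Rinv_0_lt_compat.
      * pose proof (INR_S_ge_1 J); lra.
      * apply pow_lt, sin_gt_0; lra.
    + pose proof PI_4; apply Rabs_le; lra. }
apply is_lim_seq_Reals; apply is_lim_seq_Reals in He.
intros eps Heps; destruct (He (eps / 2) ltac:(lra)) as [N HN].
exists N; intros n Hn; specialize (HN n Hn); specialize (H n).
unfold R_dist in *; rewrite Rminus_0_r in HN.
pose proof (Rle_abs (e n)); lra.
Qed.

(** * The Fourier series at the corners *)

Lemma psum_inv_root4_odd_freq (J : nat) :
  psum (fun j => / root4 (odd_freq j) ^ 5) J <= 30.
Proof.
eapply Rle_trans; [|apply (psum_inv_root4_pow5 J)].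
apply psum_le; intros j _.
pose proof (root4_ge_1 _ (INR_S_ge_1 j)).
apply Rinv_le_contravar; [apply pow_lt; lra|].
apply pow_incr; split; [lra|].
apply root4_incr, le_INR; lia.
Qed.

(* The exponent 3 makes the comparison at [t = 0] below uniform in [J]: with
   [k = a^4] the frequency, [(1 - cos (k s^4)) / k^2 <= 2 s^3 / a^5] is summable. *)
Lemma one_minus_cos_le (s : R) : 0 <= s -> 1 - cos (s ^ 4) <= 2 * s ^ 3.
Proof.
intros Hs; pose proof (COS_bound (s ^ 4)).
assert (0 <= s ^ 3) by (apply pow_le; lra).
destruct (Rle_lt_dec 1 s) as [H1|H1].
- assert (1 <= s ^ 3) by (apply pow_R1_Rle; lra); lra.
- pose proof (derive_bound cos (fun x => - sin x) 1 0 (s ^ 4)) as Hd.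
  rewrite cos_0, Rminus_0_r, (Rabs_pos_eq (s ^ 4)) in Hd by (apply pow_le; lra).
  assert (Rabs (cos (s ^ 4) - 1) <= 1 * s ^ 4) as Hc.
  { apply Hd; intros x _.
    - auto_derive; [trivial|ring].
    - rewrite Rabs_Ropp; apply Rabs_le, SIN_bound. }
  apply Rabs_le_between in Hc.
  assert (s ^ 4 <= s ^ 3) by (change (s ^ 4) with (s * s ^ 3); nra); lra.
Qed.

(** Equicontinuity of the partial sums at 0: the constant [60 = 2 * 30] is free of [J], so the limit
    passes from the open interval to its end. *)
Lemma cos_sum_near_0 (J : nat) (s : R) : 0 <= s ->
  Rabs (cos_sum J 0 - cos_sum J (s ^ 4)) <= 60 * s ^ 3.
Proof.
intros Hs; unfold cos_sum.
assert (H3 : 0 <= s ^ 3) by (apply pow_le; lra).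
apply (Rle_trans _ (psum (fun j => 2 * s ^ 3 * / root4 (odd_freq j) ^ 5) J)).
2:{ rewrite psum_scal; pose proof (psum_inv_root4_odd_freq J).
    apply (Rmult_le_compat_l (2 * s ^ 3)) in H; lra. }
replace (psum (fun j => cos (odd_freq j * 0) / odd_freq j ^ 2) J
  - psum (fun j => cos (odd_freq j * s ^ 4) / odd_freq j ^ 2) J)
  with (psum (fun j => (1 - cos (odd_freq j * s ^ 4)) / odd_freq j ^ 2) J).
- apply psum_Rabs_le; intros j _.
  pose proof (odd_freq_ge_1 j) as H1; pose proof (root4_ge_1 _ H1) as Ha.
  rewrite <- (root4_pow (odd_freq j)) at 1 2 by lra.
  set (a := root4 (odd_freq j)) in *; clearbody a.
  replace (a ^ 4 * s ^ 4) with ((a * s) ^ 4) by ring.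
  pose proof (one_minus_cos_le (a * s) ltac:(nra)) as Hc.
  pose proof (COS_bound ((a * s) ^ 4)).
  rewrite Rabs_pos_eq.
  + replace (2 * s ^ 3 * / a ^ 5) with (2 * (a * s) ^ 3 * / (a ^ 4) ^ 2) by (field; lra).
    apply Rmult_le_compat_r; trivial; left; apply Rinv_0_lt_compat; repeat apply pow_lt; lra.
  + apply Rdiv_le_0_compat; [lra|]; repeat apply pow_lt; lra.
- rewrite (psum_ext (fun j => (1 - cos (odd_freq j * s ^ 4)) / odd_freq j ^ 2)
    (fun j => cos (odd_freq j * 0) / odd_freq j ^ 2
       + -1 * (cos (odd_freq j * s ^ 4) / odd_freq j ^ 2))).
  + rewrite psum_plus, psum_scal; ring.
  + intros j _; rewrite Rmult_0_r, cos_0; field; pose proof (odd_freq_ge_1 j); lra.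
Qed.

Lemma is_lim_seq_cos_sum (t : R) : 0 <= t < PI ->
  is_lim_seq (fun J => cos_sum J t) (PI ^ 2 / 8 - PI * t / 4).
Proof.
intros [[Ht| <-] HtP]; [apply is_lim_seq_cos_sum_open; lra|].
apply is_lim_seq_Reals; intros eps Heps.
(* Both [60 s^3] and the change [PI s^4 / 4] of the limit must fit into [eps / 2]; together they are
   at most [61 s]. *)
set (s := Rmin 1 (eps / 124)).
assert (Hs : 0 < s <= 1 /\ s <= eps / 124).
{ unfold s, Rmin; destruct (Rle_dec 1 (eps / 124)); lra. }
assert (Hs3 : s ^ 3 <= s) by (simpl; nra).
assert (Hs4 : 0 < s ^ 4 <= s) by (split; [apply pow_lt; lra|simpl; nra]).
pose proof PI2_1; pose proof PI_4.
pose proof (is_lim_seq_cos_sum_open (s ^ 4) ltac:(lra)) as Hl.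
apply is_lim_seq_Reals in Hl; destruct (Hl (eps / 2) ltac:(lra)) as [N HN].
exists N; intros n Hn; specialize (HN n Hn).
pose proof (cos_sum_near_0 n s ltac:(lra)) as H60.
unfold R_dist in *.
apply Rabs_def2 in HN; apply Rabs_le_between in H60.
assert (0 <= PI * s ^ 4 / 4 <= s ^ 4) by nra.
apply Rabs_def1; lra.
Qed.

(* The value at [n + f], for [0 <= f <= 1], of the mean-zero triangular wave [S]. *)
Definition tri_wave (n : nat) (f : R) : R := (-1) ^ n * (1 / 4 - f / 2).

(** Translation by [PI] changes the sign of a cosine of odd frequency, which reduces the claim to
    [[0, PI)]. *)
Lemma is_lim_seq_tri_wave (n : nat) (f : R) : 0 <= f < 1 ->
  is_lim_seq (fun J => cos_sum J (PI * (INR n + f))) (PI ^ 2 / 2 * tri_wave n f).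
Proof.
intros Hf; pose proof PI_RGT_0.
apply (is_lim_seq_ext (fun J => (-1) ^ n * cos_sum J (PI * f))).
- intros J; unfold cos_sum; rewrite <- psum_scal; apply psum_ext; intros j _.
  replace (odd_freq j * (PI * (INR n + f))) with
    (odd_freq j * (PI * f) + INR (n + 2 * (j * n)) * PI).
  + rewrite cos_add_INR_PI, pow_add, pow_1_even; unfold Rdiv; ring.
  + rewrite odd_freq_eq, plus_INR, !mult_INR; simpl; ring.
- replace (PI ^ 2 / 2 * tri_wave n f) with ((-1) ^ n * (PI ^ 2 / 8 - PI * (PI * f) / 4))
    by (unfold tri_wave; field).
  apply (is_lim_seq_scal_l _ _ (PI ^ 2 / 8 - PI * (PI * f) / 4)), is_lim_seq_cos_sum; nra.
Qed.

(** For each truncation [J] the sums are exchanged. Frequency [k = a^4] replaces [g] by [a * g], so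
    its share is [2972 (a g)^3 / k^2 = 2972 g^3 / a^5]; summing over [k] gives [89160 = 2972 * 30],
    and the bound survives the limit in [J]. *)
Lemma alternating_tri_wave_sum (g : R) (N : nat) (n : nat -> nat) (f : nat -> R) :
  1 <= g -> INR N ^ 2 <= g ^ 4 ->
  (forall i, (i < N)%nat -> g ^ 4 / INR (S i) = INR (n i) + f i /\ 0 <= f i < 1) ->
  Rabs (psum (fun i => (-1) ^ i * INR (S i) * tri_wave (n i) (f i)) N) <= 89160 * g ^ 3.
Proof.
intros Hg HN Hnf.
set (X := psum _ N).
assert (Hlim : is_lim_seq
  (fun J => psum (fun i => (-1) ^ i * INR (S i) * cos_sum J (PI * (g ^ 4 / INR (S i)))) N)
  (PI ^ 2 / 2 * X)).
{ unfold X; rewrite <- psum_scal.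
  apply (is_lim_seq_psum (fun i J => (-1) ^ i * INR (S i) * cos_sum J (PI * (g ^ 4 / INR (S i))))).
  intros i Hi; destruct (Hnf i Hi) as [-> Hf].
  replace (PI ^ 2 / 2 * ((-1) ^ i * INR (S i) * tri_wave (n i) (f i)))
    with ((-1) ^ i * INR (S i) * (PI ^ 2 / 2 * tri_wave (n i) (f i))) by ring.
  apply (is_lim_seq_scal_l _ _ (PI ^ 2 / 2 * tri_wave (n i) (f i))), is_lim_seq_tri_wave, Hf. }
assert (Hbound : forall J,
  Rabs (psum (fun i => (-1) ^ i * INR (S i) * cos_sum J (PI * (g ^ 4 / INR (S i)))) N)
   <= 89160 * g ^ 3).
{ intros J; unfold cos_sum.
  rewrite (psum_ext _ (fun i => psum (fun j => (-1) ^ i * INR (S i) *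
    (cos (odd_freq j * (PI * (g ^ 4 / INR (S i)))) / odd_freq j ^ 2)) J))
    by (intros i _; now rewrite psum_scal).
  rewrite psum_swap.
  apply (Rle_trans _ (psum (fun j => 2972 * g ^ 3 * / root4 (odd_freq j) ^ 5) J)).
  - apply psum_Rabs_le; intros j _.
    pose proof (odd_freq_ge_1 j) as H1; pose proof (root4_ge_1 _ H1) as Ha.
    pose proof (root4_pow (odd_freq j) ltac:(lra)) as Ha4.
    set (a := root4 (odd_freq j)) in *; clearbody a.
    rewrite (psum_ext _ (fun i => / (a ^ 8) * (INR (S i) * osc cos ((a * g) ^ 4) i))).
    + rewrite psum_scal, Rabs_mult.
      assert (H8 : 0 < / a ^ 8) by (apply Rinv_0_lt_compat, pow_lt; lra).
      rewrite Rabs_pos_eq by lra.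
      replace (2972 * g ^ 3 * / a ^ 5) with (/ a ^ 8 * (2972 * (a * g) ^ 3)) by (field; lra).
      apply Rmult_le_compat_l; [lra|].
      apply osc_cos_sum; [nra|].
      apply (Rle_trans _ (g ^ 4)); trivial; apply pow_incr; nra.
    + intros i _; unfold osc; rewrite <- Ha4.
      replace (PI * ((a * g) ^ 4 / INR (S i))) with (a ^ 4 * (PI * (g ^ 4 / INR (S i))))
        by (pose proof (INR_S_ge_1 i); field; lra).
      field; lra.
  - rewrite psum_scal; pose proof (psum_inv_root4_odd_freq J) as H30.
    apply (Rmult_le_compat_l (2972 * g ^ 3)) in H30; [lra|].
    pose proof (pow_lt g 3 ltac:(lra)); lra. }
apply is_lim_seq_abs in Hlim.
assert (H : Rabs (PI ^ 2 / 2 * X) <= 89160 * g ^ 3).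
{ apply (is_lim_seq_le _ _ (Rabs (PI ^ 2 / 2 * X)) (89160 * g ^ 3) Hbound); trivial.
  apply is_lim_seq_const. }
pose proof PI2_1; rewrite Rabs_mult, Rabs_pos_eq in H by nra.
pose proof (Rabs_pos X).
assert (1 <= PI ^ 2 / 2) by nra; nra.
Qed.

(** * Wallis product and alternating sums of logarithms *)

Definition wallis_int (n : nat) : R := RInt (fun t => sin t ^ n) 0 (PI / 2).

Lemma ex_RInt_sin_pow (n : nat) (a b : R) : ex_RInt (fun t => sin t ^ n) a b.
Proof.
apply (ex_RInt_continuous (V := R_CompleteNormedModule)); intros z _.
apply (ex_derive_continuous (K := R_AbsRing) (V := R_NormedModule)).
auto_derive; trivial.
Qed.

Lemma wallis_int_0 : wallis_int 0 = PI / 2.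
Proof.
unfold wallis_int; rewrite (RInt_ext _ (fun _ => 1)) by reflexivity.
rewrite RInt_const; unfold scal; simpl; unfold mult; simpl; ring.
Qed.

Lemma wallis_int_1 : wallis_int 1 = 1.
Proof.
assert (H : is_RInt (fun t => sin t ^ 1) 0 (PI / 2) (minus (- cos (PI / 2)) (- cos 0))).
{ apply (is_RInt_derive (V := R_CompleteNormedModule) (fun t => - cos t)).
  - intros x _; auto_derive; [trivial|ring].
  - intros x _; apply (ex_derive_continuous (K := R_AbsRing) (V := R_NormedModule)).
    auto_derive; trivial. }
unfold wallis_int; rewrite (is_RInt_unique _ _ _ _ H), cos_PI2, cos_0.
unfold minus, plus, opp; simpl; ring.
Qed.

(** Integrates the derivative of [- cos t * sin t ^ S n], a function that vanishes at both ends. *)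
Lemma wallis_int_rec (n : nat) :
  (INR n + 2) * wallis_int (S (S n)) = (INR n + 1) * wallis_int n.
Proof.
assert (H1 : is_RInt (fun t => (INR n + 2) * sin t ^ S (S n) - (INR n + 1) * sin t ^ n)
               0 (PI / 2) ((INR n + 2) * wallis_int (S (S n)) - (INR n + 1) * wallis_int n)).
{ apply (is_RInt_minus (V := R_NormedModule));
    apply (is_RInt_scal (V := R_NormedModule)), (RInt_correct (V := R_CompleteNormedModule)),
      ex_RInt_sin_pow. }
assert (H2 : is_RInt (fun t => (INR n + 2) * sin t ^ S (S n) - (INR n + 1) * sin t ^ n)
    0 (PI / 2) (minus (- cos (PI / 2) * sin (PI / 2) ^ S n) (- cos 0 * sin 0 ^ S n))).
{ apply (is_RInt_derive (V := R_CompleteNormedModule) (fun t => - cos t * sin t ^ S n)).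
  - intros x _; auto_derive; [trivial|].
    pose proof (sin2_cos2 x) as H; unfold Rsqr in H.
    change (match n with 0%nat => 1 | S _ => INR n + 1 end) with (INR (S n)); rewrite S_INR.
    rewrite <- !tech_pow_Rmult.
    transitivity (sin x * (sin x * sin x ^ n) - (INR n + 1) * (cos x * cos x) * sin x ^ n);
      [ring|].
    replace (cos x * cos x) with (1 - sin x * sin x) by lra; ring.
  - intros x _; apply (ex_derive_continuous (K := R_AbsRing) (V := R_NormedModule)).
    auto_derive; trivial. }
apply (is_RInt_unique (V := R_CompleteNormedModule)) in H1.
apply (is_RInt_unique (V := R_CompleteNormedModule)) in H2.
rewrite H1, cos_PI2, sin_0 in H2; unfold minus, plus, opp in H2; simpl in H2; lra.
Qed.

Lemma wallis_int_decr (n : nat) : wallis_int (S n) <= wallis_int n.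
Proof.
pose proof PI_RGT_0; unfold wallis_int; apply RInt_le; [lra|apply ex_RInt_sin_pow..|].
intros x Hx; simpl; pose proof (SIN_bound x).
assert (0 < sin x) by (apply sin_gt_0; lra).
assert (0 <= sin x ^ n) by (apply pow_le; lra); nra.
Qed.

(** For [n = 2 k], [exp (- alt_log n)] is the Wallis product [2/1 * 4/3 * ... * 2k/(2k-1)]. *)
Definition alt_log (n : nat) : R := psum (fun i => (-1) ^ i * ln (INR (S i))) n.

Lemma exp_alt_log_step (k : nat) :
  exp (- alt_log (2 * S k)) * (2 * INR k + 1) = exp (- alt_log (2 * k)) * (2 * INR k + 2).
Proof.
pose proof (pos_INR k).
replace (2 * S k)%nat with (S (S (2 * k))) by lia.
unfold alt_log; cbn [psum]; fold (alt_log (2 * k)).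
rewrite <- tech_pow_Rmult, pow_1_even, !S_INR, mult_INR; simpl INR.
replace (- (alt_log (2 * k) + 1 * ln ((1 + 1) * INR k + 1)
            + -1 * 1 * ln ((1 + 1) * INR k + 1 + 1)))
  with (- alt_log (2 * k) + - ln (2 * INR k + 1) + ln (2 * INR k + 2)).
- rewrite !exp_plus, (exp_Ropp (ln _)), !exp_ln by lra; field; lra.
- replace ((1 + 1) * INR k + 1 + 1) with (2 * INR k + 2) by ring.
  replace ((1 + 1) * INR k + 1) with (2 * INR k + 1) by ring; ring.
Qed.

Lemma wallis_int_alt_log (k : nat) :
  wallis_int (2 * k) * exp (- alt_log (2 * k)) = PI / 2 /\
  wallis_int (2 * k + 1) * (2 * INR k + 1) = exp (- alt_log (2 * k)).
Proof.
induction k as [|k [IH1 IH2]].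
- simpl Nat.mul; unfold alt_log; simpl psum; rewrite Ropp_0, exp_0, wallis_int_0.
  simpl Nat.add; rewrite wallis_int_1; simpl; lra.
- pose proof (exp_alt_log_step k) as Hs; pose proof (pos_INR k).
  pose proof (wallis_int_rec (2 * k)) as H1; pose proof (wallis_int_rec (2 * k + 1)) as H2.
  rewrite plus_INR, mult_INR in *; simpl INR in *.
  replace (2 * S k)%nat with (S (S (2 * k))) in * by lia.
  replace (S (S (2 * k)) + 1)%nat with (S (S (2 * k + 1))) by lia.
  set (P := exp (- alt_log (2 * k))) in *; set (P' := exp (- alt_log (S (S (2 * k))))) in *.
  change (match k with 0%nat => 1 | S _ => INR k + 1 end) with (INR (S k)); rewrite S_INR.
  assert (HP : P' = P * (2 * INR k + 2) / (2 * INR k + 1)) by (rewrite <- Hs; field; lra).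
  assert (HW1 : wallis_int (S (S (2 * k)))
    = (2 * INR k + 1) / (2 * INR k + 2) * wallis_int (2 * k)).
  { apply (Rmult_eq_reg_l (2 * INR k + 2)); [|lra].
    replace (2 * INR k + 2) with ((1 + 1) * INR k + 2) at 1 by ring; rewrite H1; field; lra. }
  assert (HW2 : wallis_int (S (S (2 * k + 1)))
    = (2 * INR k + 2) / (2 * INR k + 3) * wallis_int (2 * k + 1)).
  { apply (Rmult_eq_reg_l (2 * INR k + 3)); [|lra].
    replace (2 * INR k + 3) with ((1 + 1) * INR k + 1 + 2) at 1 by ring; rewrite H2; field; lra. }
  split.
  + rewrite HP, HW1, <- IH1; field; lra.
  + rewrite HP, HW2, <- IH2; field; lra.
Qed.

(** With [P] the Wallis product, the integrals of index [2k] and [2k + 1] are [PI / (2 P)] and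
    [P / (2k + 1)]. Their monotonicity in the index squeezes [P^2] between [(PI / 2) (2k)] and
    [(PI / 2) (2k + 1)]; then take logarithms. *)
Lemma alt_log_wallis (k : nat) : (1 <= k)%nat ->
  0 <= - alt_log (2 * k) - 1 / 2 * ln (2 * INR k) - 1 / 2 * ln (PI / 2) <= / (4 * INR k).
Proof.
intros Hk; apply le_INR in Hk; simpl in Hk.
pose proof PI2_1 as HPI.
destruct (wallis_int_alt_log k) as [H1 H2].
pose proof (wallis_int_decr (2 * k)) as Hd1; pose proof (wallis_int_decr (S (2 * k))) as Hd2.
pose proof (wallis_int_rec (2 * k)) as Hr.
rewrite mult_INR in Hr; simpl INR in Hr.
replace (2 * k + 1)%nat with (S (2 * k)) in * by lia.
pose proof (exp_pos (- alt_log (2 * k))) as HP.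
set (L := - alt_log (2 * k)) in *.
assert (HL : exp L * exp L = exp (2 * L)) by (rewrite <- exp_plus; f_equal; ring).
set (m := INR k) in *; clearbody m.
assert (Hu : exp L * exp L <= PI / 2 * (2 * m + 1)).
{ rewrite <- H1; rewrite <- H2 at 1.
  replace (wallis_int (S (2 * k)) * (2 * m + 1) * exp L)
    with ((2 * m + 1) * exp L * wallis_int (S (2 * k))) by ring.
  replace (wallis_int (2 * k) * exp L * (2 * m + 1))
    with ((2 * m + 1) * exp L * wallis_int (2 * k)) by ring.
  apply Rmult_le_compat_l; trivial; nra. }
assert (Hl : PI / 2 * (2 * m) <= exp L * exp L).
{ assert (H : (2 * m + 1) * (2 * m + 1) * (PI / 2) <= (2 * m + 2) * (exp L * exp L)).
  { rewrite <- H1; rewrite <- H2 at 2.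
    replace ((2 * m + 1) * (2 * m + 1) * (wallis_int (2 * k) * exp L))
      with ((2 * m + 1) * exp L * (((1 + 1) * m + 1) * wallis_int (2 * k))) by ring.
    rewrite <- Hr.
    replace ((2 * m + 2) * (wallis_int (S (2 * k)) * (2 * m + 1) * exp L))
      with ((2 * m + 1) * exp L * (((1 + 1) * m + 2) * wallis_int (S (2 * k)))) by ring.
    apply Rmult_le_compat_l; [nra|]; apply Rmult_le_compat_l; [lra|trivial]. }
  nra. }
rewrite HL in Hu, Hl.
apply ln_le in Hu; [|apply exp_pos]; apply ln_le in Hl; [|nra].
rewrite ln_exp, ln_mult in Hu, Hl by lra.
assert (Hln : ln (2 * m + 1) <= ln (2 * m) + / (2 * m)).
{ replace (2 * m + 1) with (2 * m * (1 + / (2 * m))) by (field; lra).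
  assert (0 < / (2 * m)) by (apply Rinv_0_lt_compat; lra).
  rewrite ln_mult by lra; apply Rplus_le_compat_l.
  rewrite <- (ln_exp (/ (2 * m))) at 2; apply ln_le; [lra|].
  apply Rlt_le, exp_ineq1; lra. }
replace (/ (4 * m)) with (1 / 2 * / (2 * m)) by (field; lra).
lra.
Qed.

(* The last term is [T(y) / y^2] with [T] the periodic antiderivative of the wave
   [S]; with it the derivative in [y] is [O(y^-3)], so that the remainder plus or
   minus [1 / (16 y^2)] is monotone. *)
Definition alt_log_rem (n : nat) (y : R) : R :=
  - alt_log n - 1 / 2 * ln (PI / 2)
  - (-1) ^ n * (1 / 2 * ln y + (1 / 4 - (y - INR n) / 2) / y
                + (y - INR n) * (1 - (y - INR n)) / (4 * y ^ 2)).

(** * Size of the remainder in the logarithmic sums *)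

Lemma sign_cases (n : nat) : (-1) ^ n = 1 \/ (-1) ^ n = -1.
Proof. induction n as [|n [IH|IH]]; simpl; [left|right; rewrite IH|left; rewrite IH]; ring. Qed.

Lemma mult_one_minus_bounds (f : R) : 0 <= f <= 1 -> 0 <= f * (1 - f) <= 1 / 4.
Proof. intros H; pose proof (Rle_0_sqr (f - 1 / 2)) as Hs; unfold Rsqr in Hs; nra. Qed.

Lemma alt_log_rem_diff (n : nat) (y z : R) :
  (1 <= n)%nat -> INR n <= y -> y <= z -> z <= INR n + 1 ->
  Rabs (alt_log_rem n z - alt_log_rem n y) <= 1 / 16 * (/ y ^ 2 - / z ^ 2).
Proof.
intros Hn Hy Hyz Hz; apply le_INR in Hn; simpl in Hn.
assert (H : forall s, s = 1 \/ s = -1 ->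
  s * (alt_log_rem n z - alt_log_rem n y) <= 1 / 16 * (/ y ^ 2 - / z ^ 2)).
{ intros s Hs.
  set (h := fun t => s * alt_log_rem n t + 1 / 16 * / t ^ 2).
  (* In the derivative the terms of order [1 / t] and [1 / t^2] cancel. The subtracted 1/4 comes
     from [1 / (16 t^2)] and is the maximum of [f (1 - f)]. *)
  set (dh := fun t => (s * (-1) ^ n * ((t - INR n) * (1 - (t - INR n))) - 1 / 4) / (2 * t ^ 3)).
  assert (Hd : forall t, Rmin y z <= t <= Rmax y z -> is_derive h t (dh t)).
  { intros t Ht; rewrite Rmin_left, Rmax_right in Ht by lra; unfold h, dh, alt_log_rem.
    auto_derive; [|field; lra].
    repeat split; try lra; apply Rgt_not_eq; repeat apply Rmult_lt_0_compat; lra. }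
  destruct (MVT_gen h y z dh) as [t [Ht E]].
  - intros t Ht; apply Hd; lra.
  - intros t Ht; apply continuity_pt_filterlim.
    apply (ex_derive_continuous (K := R_AbsRing) (V := R_NormedModule)).
    exists (dh t); auto.
  - rewrite Rmin_left, Rmax_right in Ht by lra.
    assert (Hneg : dh t <= 0).
    { unfold dh; assert (0 < / (2 * t ^ 3)).
      { apply Rinv_0_lt_compat; pose proof (pow_lt t 3 ltac:(lra)); lra. }
      pose proof (mult_one_minus_bounds (t - INR n) ltac:(lra)).
      assert (s * (-1) ^ n * ((t - INR n) * (1 - (t - INR n))) <= 1 / 4).
      2:{ unfold Rdiv; match goal with |- ?u * _ <= 0 => assert (u <= 0) by lra; nra end. }
      destruct Hs as [-> | ->], (sign_cases n) as [-> | ->]; lra. }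
    assert (h z - h y <= 0) by (rewrite E; nra).
    unfold h in *; lra. }
pose proof (H 1 ltac:(auto)); pose proof (H (-1) ltac:(auto)).
apply Rabs_le; lra.
Qed.

(** Continuity across integers: the flip of [(-1)^n] absorbs the jump of [alt_log], the wave is
    continuous, and the last term vanishes at both ends. *)
Lemma alt_log_rem_glue (n : nat) :
  alt_log_rem n (INR n + 1) = alt_log_rem (S n) (INR (S n)).
Proof.
unfold alt_log_rem; unfold alt_log at 2; cbn [psum]; fold (alt_log n).
change ((-1) ^ S n) with (-1 * (-1) ^ n); rewrite S_INR; pose proof (pos_INR n); field; lra.
Qed.

Lemma alt_log_rem_nat_diff (n k : nat) : (1 <= n)%nat ->
  Rabs (alt_log_rem (n + k) (INR (n + k)) - alt_log_rem n (INR n))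
    <= 1 / 16 * (/ INR n ^ 2 - / INR (n + k) ^ 2).
Proof.
intros Hn; induction k as [|k IH].
- rewrite Nat.add_0_r, !Rminus_diag, Rabs_R0; lra.
- rewrite Nat.add_succ_r, <- alt_log_rem_glue, S_INR.
  pose proof (alt_log_rem_diff (n + k) (INR (n + k)) (INR (n + k) + 1)
    ltac:(lia) ltac:(lra) ltac:(lra) ltac:(lra)) as H.
  apply Rabs_le_between in H, IH; apply Rabs_le; lra.
Qed.

(** The remainder tends to 0 along even integers by Wallis, so its size at [n] is at most its total
    variation beyond [n], which telescopes. *)
Lemma alt_log_rem_nat (n : nat) : (1 <= n)%nat ->
  Rabs (alt_log_rem n (INR n)) <= 1 / 16 * / INR n ^ 2.
Proof.
intros Hn; apply Rle_plus_epsilon; intros eps Heps.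
destruct (INR_unbounded (/ eps)) as [K HK].
set (k := (n + K)%nat).
assert (Hk : / INR k < eps).
{ rewrite <- (Rinv_inv eps); apply Rinv_lt_contravar.
  - apply Rmult_lt_0_compat; [apply Rinv_0_lt_compat; lra|apply lt_0_INR; unfold k; lia].
  - unfold k; rewrite plus_INR; pose proof (pos_INR n); lra. }
pose proof (alt_log_wallis k ltac:(unfold k; lia)) as Hw.
assert (Hk0 : 0 < INR k) by (apply lt_0_INR; unfold k; lia).
assert (Hlim : Rabs (alt_log_rem (2 * k) (INR (2 * k))) <= / INR k).
{ unfold alt_log_rem; rewrite pow_1_even, mult_INR.
  replace (INR 2) with 2 by reflexivity.
  replace ((1 / 4 - (2 * INR k - 2 * INR k) / 2) / (2 * INR k)) with (/ 8 * / INR k)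
    by (field; lra).
  replace ((2 * INR k - 2 * INR k) * (1 - (2 * INR k - 2 * INR k)) / (4 * (2 * INR k) ^ 2))
    with 0 by (field; lra).
  rewrite Rinv_mult in Hw; apply Rabs_le; lra. }
pose proof (alt_log_rem_nat_diff n (2 * k - n) Hn) as Hd.
replace (n + (2 * k - n))%nat with (2 * k)%nat in Hd by (unfold k; lia).
assert (0 < / INR (2 * k) ^ 2).
{ apply Rinv_0_lt_compat, pow_lt, lt_0_INR; unfold k; lia. }
apply Rabs_le_between in Hd, Hlim; apply Rabs_le; lra.
Qed.

Lemma alt_log_rem_bound (n : nat) (y : R) :
  (1 <= n)%nat -> INR n <= y <= INR n + 1 ->
  Rabs (alt_log_rem n y) <= 1 / 16 * / y ^ 2.
Proof.
intros Hn Hy.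
pose proof (alt_log_rem_diff n y (INR n + 1) Hn ltac:(lra) ltac:(lra) ltac:(lra)) as H1.
pose proof (alt_log_rem_nat (S n) ltac:(lia)) as H2.
rewrite alt_log_rem_glue in H1; rewrite S_INR in *.
apply Rabs_le_between in H1, H2; apply Rabs_le; lra.
Qed.

(** The first two terms are the sum of [(-1)^(b-1) ln (y / b)] over [b <= n]. Of the 1/8, one half
    is the remainder and the other the discarded term in [1 / y^2]. *)
Lemma alt_log_asymp (n : nat) (y : R) :
  (1 <= n)%nat -> INR n <= y <= INR n + 1 ->
  Rabs ((1 - (-1) ^ n) / 2 * ln y - alt_log n
     - (1 / 2 * ln y + 1 / 2 * ln (PI / 2) + tri_wave n (y - INR n) / y)) <= / 8 * / y ^ 2.
Proof.
intros Hn Hy; pose proof (alt_log_rem_bound n y Hn Hy) as H.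
apply le_INR in Hn; simpl in Hn.
set (f := y - INR n) in *.
assert (HT : Rabs ((-1) ^ n * (f * (1 - f) / (4 * y ^ 2))) <= 1 / 16 * / y ^ 2).
{ rewrite Rabs_sign_mult.
  assert (0 < / y ^ 2) by (apply Rinv_0_lt_compat, pow_lt; lra).
  pose proof (mult_one_minus_bounds f ltac:(unfold f; lra)).
  replace (f * (1 - f) / (4 * y ^ 2)) with (f * (1 - f) * (1 / 4 * / y ^ 2)) by (field; lra).
  rewrite Rabs_pos_eq by nra; nra. }
replace (_ - _) with (alt_log_rem n y + (-1) ^ n * (f * (1 - f) / (4 * y ^ 2))).
- eapply Rle_trans; [apply Rabs_triang|lra].
- unfold alt_log_rem, tri_wave; fold f; field; lra.
Qed.

(** * The hyperbola method *)

Definition ln_plus (t : R) : R := ln (Rmax 1 t).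

Lemma ln_plus_le_1 (t : R) : t <= 1 -> ln_plus t = 0.
Proof. intros H; unfold ln_plus; rewrite Rmax_left, ln_1; trivial. Qed.

Lemma ln_plus_ge_1 (t : R) : 1 <= t -> ln_plus t = ln t.
Proof. intros H; unfold ln_plus; rewrite Rmax_right; trivial. Qed.

(** Half-lines in place of intervals: each interval is a difference of two, and the integrand
    becomes [1 / u] on [[q, x / p]], with a closed-form integral. *)
Definition halfline (p q x u : R) : R :=
  chi (fun v => p <= v) (x / u) * chi (fun v => q <= v) u / u.

Lemma is_RInt_halfline (p q x : R) : 1 <= p -> 1 <= q -> 1 <= x ->
  is_RInt (halfline p q x) 1 x (ln_plus (x / (p * q))).
Proof.
intros Hp Hq Hx.
assert (Hpq : 0 < p * q) by nra.
assert (Hiff : forall u, 0 < u -> p <= x / u <-> u <= x / p).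
{ intros u Hu; split; intros H.
  - apply (Rmult_le_reg_r p); [lra|].
    apply (Rmult_le_compat_r u) in H; [|lra].
    replace (x / u * u) with x in H by (field; lra).
    replace (x / p * p) with x by (field; lra); lra.
  - apply (Rmult_le_reg_r u); [lra|].
    apply (Rmult_le_compat_r p) in H; [|lra].
    replace (x / p * p) with x in H by (field; lra).
    replace (x / u * u) with x by (field; lra); lra. }
assert (Hzero : forall a b, a <= b -> 0 <= a ->
  (forall u, a < u < b -> u < q \/ x / p < u) -> is_RInt (halfline p q x) a b 0).
{ intros a b Hab Ha H.
  apply (is_RInt_ext (fun _ => 0)).
  - rewrite Rmin_left, Rmax_right by lra; intros u Hu; unfold halfline.
    match goal with |- ?a = ?b => change (a = b :> R) end.
    specialize (Hiff u ltac:(lra)).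
    destruct (H u Hu) as [H'|H'].
    + rewrite (chi_notin _ u) by lra; unfold Rdiv; ring.
    + rewrite (chi_notin _ (x / u)) by (rewrite Hiff; lra); unfold Rdiv; ring.
  - pose proof (is_RInt_const (V := R_NormedModule) a b 0) as H0.
    change (scal (b - a) 0) with ((b - a) * 0) in H0; rewrite Rmult_0_r in H0; exact H0. }
destruct (Rle_lt_dec q (x / p)) as [H|H].
- assert (HxP : x / p <= x).
  { apply (Rmult_le_reg_r p); [lra|]; replace (x / p * p) with x by (field; lra); nra. }
  rewrite ln_plus_ge_1.
  + replace (ln (x / (p * q))) with (plus (plus 0 (ln (x / p) - ln q)) 0).
    * apply (is_RInt_Chasles (V := R_NormedModule) _ 1 (x / p) x);
        [apply (is_RInt_Chasles (V := R_NormedModule) _ 1 q (x / p))|].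
      -- apply Hzero; [lra|lra|]; intros u Hu; left; lra.
      -- apply (is_RInt_ext (fun u => / u)).
         ++ rewrite Rmin_left, Rmax_right by lra; intros u Hu; unfold halfline.
            match goal with |- ?a = ?b => change (a = b :> R) end.
            rewrite !chi_in by (try apply Hiff; lra); field; lra.
         ++ apply (is_RInt_derive (V := R_CompleteNormedModule) ln);
              rewrite Rmin_left, Rmax_right by lra; intros u Hu.
            ** auto_derive; [lra|field; lra].
            ** apply continuous_Rinv; lra.
      -- apply Hzero; [lra|lra|]; intros u Hu; right; lra.
    * unfold plus; simpl; rewrite Rplus_0_l, Rplus_0_r.
      replace (x / (p * q)) with (x / p / q) by (field; lra).
      rewrite <- ln_div; try lra; apply Rdiv_lt_0_compat; lra.
  + apply (Rmult_le_reg_r q); [lra|]; replace (x / (p * q) * q) with (x / p) by (field; lra); lra.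
- rewrite ln_plus_le_1.
  + apply Hzero; [lra|lra|]; intros u Hu; destruct (Rlt_le_dec u q); [left|right]; lra.
  + apply (Rmult_le_reg_r q); [lra|]; replace (x / (p * q) * q) with (x / p) by (field; lra); lra.
Qed.

Lemma chi_Ico (a b v : R) : a <= b ->
  chi (Ico a b) v = chi (fun t => a <= t) v - chi (fun t => b <= t) v.
Proof.
intros H; unfold Ico; destruct (Rle_lt_dec a v), (Rle_lt_dec b v);
  repeat first [rewrite chi_in by lra | rewrite chi_notin by lra]; lra.
Qed.

(** With zero-based [m], the ends of the interval are [S (2 * m)] and [S (2 * m + 1)]; the four
    corners carry the signs of the alternating double sum. *)
Lemma RInt_phi_integrand (x : R) (m n : nat) : 1 <= x ->
  let g a b := ln_plus (x / (INR a * INR b)) in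
  RInt (phi_integrand x (S m) (S n)) 1 x =
   g (S (2 * m)) (S (2 * n)) - g (S (2 * m)) (S (2 * n + 1))
   - (g (S (2 * m + 1)) (S (2 * n)) - g (S (2 * m + 1)) (S (2 * n + 1))).
Proof.
intros Hx g; apply is_RInt_unique.
assert (E0 : forall k, 2 * INR (S k) - 1 = INR (S (2 * k))).
{ intros k; rewrite !S_INR, mult_INR; simpl; ring. }
assert (E1 : forall k, 2 * INR (S k) = INR (S (2 * k + 1))).
{ intros k; rewrite !S_INR, plus_INR, mult_INR; simpl; ring. }
apply (is_RInt_ext (fun u =>
  minus (minus (halfline (INR (S (2 * m))) (INR (S (2 * n))) x u)
               (halfline (INR (S (2 * m))) (INR (S (2 * n + 1))) x u))
        (minus (halfline (INR (S (2 * m + 1))) (INR (S (2 * n))) x u)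
               (halfline (INR (S (2 * m + 1))) (INR (S (2 * n + 1))) x u)))).
- intros u _; match goal with |- ?a = ?b => change (a = b :> R) end.
  unfold phi_integrand; rewrite !chi_Ico by lra.
  rewrite !E0, !E1; unfold halfline, minus, plus, opp, Rdiv; simpl; ring.
- apply (is_RInt_minus (V := R_NormedModule));
    apply (is_RInt_minus (V := R_NormedModule));
    apply is_RInt_halfline; trivial; apply INR_S_ge_1.
Qed.

(** * From the double series to a finite double sum *)

Lemma Series_psum (a : nat -> R) (K : nat) :
  (forall n, (K <= n)%nat -> a n = 0) -> Series a = psum a K.
Proof.
intros H; unfold Series.
replace (psum a K) with (real (Finite (psum a K))) by reflexivity.
f_equal; apply is_lim_seq_unique.
apply (is_lim_seq_ext_loc (fun _ => psum a K)); [|apply is_lim_seq_const].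
exists K; intros n Hn.
transitivity (psum a (S n)).
- replace (S n) with (K + (S n - K))%nat by lia; rewrite psum_add.
  rewrite (psum_ext (fun i => a (K + i)%nat) (fun _ => 0)) by (intros; apply H; lia).
  rewrite psum_const; ring.
- clear; induction n as [|n IH]; [rewrite sum_O; simpl; ring|].
  rewrite sum_Sn, <- IH; reflexivity.
Qed.

(* [a] and [b] stand for the divisors [S a] and [S b]. *)
Definition term (x : R) (a b : nat) : R :=
  (-1) ^ a * (-1) ^ b * ln_plus (x / (INR (S a) * INR (S b))).

Lemma phi_double_sum (x : R) (K : nat) : 1 <= x -> x <= INR K ->
  phi x = psum (fun a => psum (term x a) (2 * K)) (2 * K).
Proof.
intros Hx HK.
assert (Hbig : forall n, (K <= n)%nat -> x < INR (S n)).
{ intros n Hn; apply le_INR in Hn; rewrite S_INR; lra. }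
unfold phi; rewrite (Series_psum _ K).
- rewrite psum_double; apply psum_ext; intros m _.
  rewrite (Series_psum _ K).
  + rewrite !psum_double, <- psum_plus; apply psum_ext; intros n _.
    rewrite (RInt_phi_integrand x m n Hx); unfold term.
    rewrite !Nat.add_1_r, <- !tech_pow_Rmult, !pow_1_even; ring.
  + intros n Hn; apply RInt_phi_integrand_eq0; auto.
- intros m Hm; rewrite (Series_psum _ O); [reflexivity|].
  intros n _; apply RInt_phi_integrand_eq0; auto.
Qed.

Lemma term_sym (x : R) (a b : nat) : term x a b = term x b a.
Proof. unfold term; rewrite (Rmult_comm (INR (S a))); ring. Qed.

(** Divisors that both exceed [N] have product at least [(N + 1)^2 > x], so their terms vanish; the
    two remaining strips agree by symmetry. *)
Lemma hyperbola (x : R) (N M : nat) : (N <= M)%nat -> 0 < x -> x < INR (S N) ^ 2 ->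
  psum (fun a => psum (term x a) M) M =
   2 * psum (fun a => psum (term x a) M) N - psum (fun a => psum (term x a) N) N.
Proof.
intros HNM Hx HN.
set (L := (M - N)%nat); replace M with (N + L)%nat by (unfold L; lia); clearbody L.
rewrite (psum_add _ N L).
rewrite (psum_ext (fun i => psum (term x (N + i)) (N + L))
  (fun i => psum (term x (N + i)) N)).
- rewrite (psum_swap (fun i j => term x (N + i) j)).
  assert (E : psum (fun b => psum (fun i => term x (N + i) b) L) N =
    psum (fun a => psum (term x a) (N + L)) N - psum (fun a => psum (term x a) N) N).
  { rewrite (psum_ext (fun a => psum (term x a) (N + L))
      (fun a => psum (term x a) N + psum (fun i => term x (N + i) a) L)).
    - rewrite psum_plus; ring.
    - intros a _; rewrite psum_add; f_equal; apply psum_ext; intros; apply term_sym. }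
  rewrite E; ring.
- intros i _; rewrite psum_add.
  rewrite (psum_ext (fun j => term x (N + i) (N + j)) (fun _ => 0)); [rewrite psum_const; ring|].
  intros j _; unfold term; rewrite ln_plus_le_1; [ring|].
  assert (H1 : INR (S N) <= INR (S (N + i))) by (apply le_INR; lia).
  assert (H2 : INR (S N) <= INR (S (N + j))) by (apply le_INR; lia).
  pose proof (INR_S_ge_1 N).
  apply (Rmult_le_reg_r (INR (S (N + i)) * INR (S (N + j)))); [nra|].
  unfold Rdiv; rewrite Rmult_assoc, Rinv_l, Rmult_1_r, Rmult_1_l by nra; nra.
Qed.

(** * Assembling the asymptotic formula *)

Lemma psum_sign (n : nat) : psum (fun i => (-1) ^ i) n = (1 - (-1) ^ n) / 2.
Proof. induction n as [|n IH]; [simpl; field|]; cbn [psum]; rewrite IH; simpl; field. Qed.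

Lemma psum_ln_plus (y : R) (n M : nat) :
  (n <= M)%nat -> (1 <= n)%nat -> INR n <= y < INR n + 1 ->
  psum (fun b => (-1) ^ b * ln_plus (y / INR (S b))) M
   = (1 - (-1) ^ n) / 2 * ln y - alt_log n.
Proof.
intros HnM Hn Hy; apply le_INR in Hn; simpl in Hn.
replace M with (n + (M - n))%nat by lia; rewrite psum_add.
rewrite (psum_ext (fun i => (-1) ^ (n + i) * ln_plus (y / INR (S (n + i)))) (fun _ => 0)).
- rewrite psum_const, Rmult_0_r, Rplus_0_r, <- psum_sign, Rmult_comm, <- psum_scal.
  unfold alt_log; rewrite (psum_ext _ (fun b => ln y * (-1) ^ b
    + -1 * ((-1) ^ b * ln (INR (S b))))).
  + rewrite psum_plus, (psum_scal (-1)); ring.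
  + intros b Hb; pose proof (INR_S_ge_1 b).
    assert (INR (S b) <= INR n) by (apply le_INR; lia).
    rewrite ln_plus_ge_1, ln_div; [ring|lra|lra|].
    apply (Rmult_le_reg_r (INR (S b))); [lra|].
    replace (y / INR (S b) * INR (S b)) with y by (field; lra); lra.
- intros i _; rewrite ln_plus_le_1; [ring|].
  assert (Hi : INR (S n) <= INR (S (n + i))) by (apply le_INR; lia).
  rewrite (S_INR n) in Hi; set (k := INR (S (n + i))) in *.
  apply (Rmult_le_reg_r k); [lra|].
  replace (y / k * k) with y by (field; lra); lra.
Qed.

(** Inside the square [a b <= N^2 <= x], so no logarithm is cut off and the sum factors into
    one-dimensional ones. *)
Lemma psum_term_square (x : R) (N : nat) : 0 < x -> INR N ^ 2 <= x ->
  let A := (1 - (-1) ^ N) / 2 in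
  psum (fun a => psum (term x a) N) N = A ^ 2 * ln x - 2 * A * alt_log N.
Proof.
intros Hx HN A.
rewrite (psum_ext _ (fun a => (A * ln x - alt_log N) * (-1) ^ a
  + - A * ((-1) ^ a * ln (INR (S a))))).
- rewrite psum_plus, !psum_scal, psum_sign; unfold alt_log, A; ring.
- intros a Ha.
  rewrite (psum_ext _ (fun b => (-1) ^ a * (ln x - ln (INR (S a))) * (-1) ^ b
     + - (-1) ^ a * ((-1) ^ b * ln (INR (S b))))).
  + rewrite psum_plus, !psum_scal, psum_sign; unfold alt_log, A; ring.
  + intros b Hb; unfold term.
    pose proof (INR_S_ge_1 a); pose proof (INR_S_ge_1 b).
    assert (INR (S a) <= INR N) by (apply le_INR; lia).
    assert (INR (S b) <= INR N) by (apply le_INR; lia).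
    assert (Hab : 0 < INR (S a) * INR (S b)) by nra.
    rewrite ln_plus_ge_1, ln_div, ln_mult; try lra.
    apply (Rmult_le_reg_r (INR (S a) * INR (S b))); [lra|].
    unfold Rdiv; rewrite Rmult_assoc, Rinv_l, Rmult_1_r, Rmult_1_l by lra; nra.
Qed.

(** Here [178323 = 2 * 89160 + 2 + 1]: the wave sum and the sum of the [theta a] enter twice, the
    defect [r] once. *)
Lemma phi_asymp (g : R) : 1 <= g ->
  Rabs (phi (g ^ 4) - (1 / 4 * ln (g ^ 4) + 1 / 2 * ln (PI / 2))) <= 178323 / g.
Proof.
intros Hg; set (x := g ^ 4).
assert (Hz : 1 <= g ^ 2) by (apply pow_R1_Rle; lra).
assert (Hxz : x = g ^ 2 * g ^ 2) by (unfold x; ring).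
assert (Hx : 1 <= x) by nra.
destruct (nfloor_ex (g ^ 2) ltac:(lra)) as [N HN].
assert (HN1 : (1 <= N)%nat).
{ destruct N; [simpl INR in HN; lra|lia]. }
pose proof (le_INR _ _ HN1) as HN1'; simpl INR in HN1'.
destruct (INR_unbounded x) as [K HK].
set (c := 1 / 2 * ln (PI / 2)) in *.
set (y := fun a : nat => x / INR (S a)).
assert (Hyz : forall a, (a < N)%nat -> g ^ 2 <= y a <= x /\ INR (S a) <= g ^ 2).
{ intros a Ha; unfold y; pose proof (INR_S_ge_1 a).
  assert (INR (S a) <= INR N) by (apply le_INR; lia).
  repeat split; [..|lra]; apply (Rmult_le_reg_r (INR (S a))); try lra;
    replace (x / INR (S a) * INR (S a)) with x by (field; lra); nra. }
assert (Hy0 : forall a, 0 <= y a).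
{ intros a; apply Rdiv_le_0_compat; [lra|apply lt_0_INR; lia]. }
set (n := fun a => proj1_sig (nfloor_ex (y a) (Hy0 a))).
assert (Hn : forall a, (a < N)%nat ->
   INR (n a) <= y a < INR (n a) + 1 /\ (1 <= n a)%nat /\ (n a <= 2 * K)%nat).
{ intros a Ha; destruct (Hyz a Ha) as [Hya _].
  assert (Hfl : INR (n a) <= y a < INR (n a) + 1)
    by exact (proj2_sig (nfloor_ex (y a) (Hy0 a))).
  split; [exact Hfl|split].
  - destruct (n a); [simpl INR in Hfl; lra|lia].
  - assert (n a < K)%nat by (apply INR_lt; lra); lia. }
clearbody n.
set (t := fun a => tri_wave (n a) (y a - INR (n a)) / y a).
set (theta := fun a => (1 - (-1) ^ n a) / 2 * ln (y a) - alt_log (n a)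
    - (1 / 2 * ln (y a) + c + t a)).
assert (Htheta : forall a, (a < N)%nat -> Rabs (theta a) <= / 8 * / y a ^ 2).
{ intros a Ha; destruct (Hn a Ha) as [H1 [H2 _]].
  apply (alt_log_asymp (n a) (y a)); trivial; lra. }
set (A := (1 - (-1) ^ N) / 2).
assert (Hcol : psum (fun a => psum (term x a) (2 * K)) N
  = A * (1 / 2 * ln x + c) - 1 / 2 * alt_log N + psum (fun a => (-1) ^ a * t a) N
    + psum (fun a => (-1) ^ a * theta a) N).
{ rewrite (psum_ext _ (fun a => (1 / 2 * ln x + c) * (-1) ^ a
     + -1 / 2 * ((-1) ^ a * ln (INR (S a))) + (-1) ^ a * t a + (-1) ^ a * theta a)).
  - rewrite !psum_plus, !psum_scal, psum_sign; unfold A, alt_log; field.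
  - intros a Ha; destruct (Hn a Ha) as [H1 [H2 H3]].
    rewrite (psum_ext _ (fun b => (-1) ^ a * ((-1) ^ b * ln_plus (y a / INR (S b))))).
    + rewrite psum_scal, (psum_ln_plus (y a) (n a)) by trivial.
      unfold theta; replace (ln (y a)) with (ln x - ln (INR (S a))).
      * field.
      * unfold y; rewrite ln_div; [trivial|lra|apply lt_0_INR; lia].
    + intros b _; unfold term, y.
      replace (x / (INR (S a) * INR (S b))) with (x / INR (S a) / INR (S b)); [ring|].
      pose proof (INR_S_ge_1 a); pose proof (INR_S_ge_1 b); field; lra. }
(* Defect of the one-dimensional formula at [y = sqrt x], wave term included in it; it is what the
   square leaves over after the main terms cancel. *)
set (r := A * ln (g ^ 2) - alt_log N - (1 / 2 * ln (g ^ 2) + c)).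
assert (Hmain : phi x - (1 / 4 * ln x + c) =
  2 * psum (fun a => (-1) ^ a * t a) N + 2 * psum (fun a => (-1) ^ a * theta a) N
  + (-1) ^ N * r).
{ rewrite (phi_double_sum x K Hx ltac:(lra)), (hyperbola x N); [| |lra|rewrite S_INR; nra].
  - rewrite Hcol, psum_term_square by nra; fold A.
    assert (Hln : ln x = 2 * ln (g ^ 2)) by (rewrite Hxz, ln_mult; lra).
    unfold r; rewrite Hln; unfold A; destruct (sign_cases N) as [-> | ->]; field.
  - assert (N <= K)%nat; [|lia]; apply INR_le; nra. }
assert (Htri : forall k f, 0 <= f <= 1 -> Rabs (tri_wave k f) <= 1 / 4).
{ intros k f Hf; unfold tri_wave; rewrite Rabs_sign_mult; apply Rabs_le; lra. }
assert (Hginv : / g ^ 2 <= / g) by (apply Rinv_le_contravar; simpl; nra).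
assert (Hg0 : 0 < / g ^ 2) by (apply Rinv_0_lt_compat; lra).
assert (Hr : Rabs r <= / g).
{ pose proof (alt_log_asymp N (g ^ 2) HN1 ltac:(lra)) as H.
  fold A c in H.
  pose proof (Htri N (g ^ 2 - INR N) ltac:(lra)) as H4.
  assert (H5 : Rabs (tri_wave N (g ^ 2 - INR N) / g ^ 2) <= 1 / 4 * / g ^ 2).
  { unfold Rdiv at 1; rewrite Rabs_mult, (Rabs_pos_eq (/ _)) by lra.
    apply Rmult_le_compat_r; lra. }
  assert (H6 : / (g ^ 2) ^ 2 <= / g ^ 2) by (apply Rinv_le_contravar; nra).
  replace r with (A * ln (g ^ 2) - alt_log N - (1 / 2 * ln (g ^ 2) + c
    + tri_wave N (g ^ 2 - INR N) / g ^ 2) + tri_wave N (g ^ 2 - INR N) / g ^ 2)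
    by (unfold r; ring).
  eapply Rle_trans; [apply Rabs_triang|lra]. }
assert (Ht : Rabs (psum (fun a => (-1) ^ a * t a) N) <= 89160 * / g).
(* Dividing by [y a = x / S a] is what creates the weight [S a] of the exponential sum. *)
{ rewrite (psum_ext _ (fun a => / x * ((-1) ^ a * INR (S a) * tri_wave (n a) (y a - INR (n a))))).
  - rewrite psum_scal, Rabs_mult, Rabs_pos_eq by (left; apply Rinv_0_lt_compat; lra).
    apply (Rle_trans _ (/ x * (89160 * g ^ 3))); [|right; unfold x; field; lra].
    apply Rmult_le_compat_l; [left; apply Rinv_0_lt_compat; lra|].
    apply alternating_tri_wave_sum; [lra|fold x; nra|].
    intros a Ha; destruct (Hn a Ha) as [H1 _]; fold x (y a); lra.
  - intros a Ha; unfold t, y; pose proof (INR_S_ge_1 a); field; lra. }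
assert (Hth : Rabs (psum (fun a => (-1) ^ a * theta a) N) <= / g).
{ apply (Rle_trans _ (INR N * (/ g ^ 2) ^ 2)).
  - rewrite <- psum_const; apply psum_Rabs_le; intros a Ha.
    rewrite Rabs_sign_mult; destruct (Hyz a Ha) as [[H1 _] _].
    eapply Rle_trans; [apply (Htheta a Ha)|].
    rewrite pow_inv.
    assert (/ y a ^ 2 <= / (g ^ 2) ^ 2) by (apply Rinv_le_contravar; nra).
    assert (0 < / y a ^ 2) by (apply Rinv_0_lt_compat; nra); lra.
  - apply (Rle_trans _ (g ^ 2 * (/ g ^ 2) ^ 2)).
    + apply Rmult_le_compat_r; [nra|lra].
    + replace (g ^ 2 * (/ g ^ 2) ^ 2) with (/ g ^ 2) by (field; lra); lra. }
fold c; rewrite Hmain.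
eapply Rle_trans; [apply Rabs_triang|]; rewrite Rabs_sign_mult.
eapply Rle_trans; [apply Rplus_le_compat_r, Rabs_triang|].
rewrite !Rabs_mult, !(Rabs_pos_eq 2) by lra.
unfold Rdiv; lra.
Qed.

Theorem theorem3 : forall eps : R, 0 < eps ->
  exists C : R, forall x : R, 1 <= x ->
    Rabs (phi x - (1 / 4 * ln x + 1 / 2 * ln (PI / 2)))
      <= C * Rpower x (eps - 1 / 4).
Proof.
(* One constant serves every [eps], since [1 / g = x^(-1/4) <= x^(eps - 1/4)] for [x >= 1]. *)
intros eps Heps; exists 178323; intros x Hx.
pose proof (root4_ge_1 x Hx) as Hg.
pose proof (root4_pow x ltac:(lra)) as Hgx.
set (g := root4 x) in *; clearbody g.
rewrite <- Hgx.
eapply Rle_trans; [apply phi_asymp; trivial|].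
unfold Rdiv at 1; apply Rmult_le_compat_l; [lra|].
unfold Rpower; rewrite ln_pow by lra.
rewrite <- (exp_ln g) at 1 by lra; rewrite <- exp_Ropp.
assert (0 <= ln g) by (rewrite <- ln_1; apply ln_le; lra).
replace (INR 4) with 4 by (simpl; ring).
destruct (Rle_lt_or_eq_dec (- ln g) ((eps - 1 / 4) * (4 * ln g)) ltac:(nra)) as [H'| ->].
- left; apply exp_increasing, H'.
- lra.
Qed.
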